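(* Let $\mathcal{X}_{(n)} = (\mathcal{X}_{(n)}, P_{(n)}, \pi_{(n)})$, $n \ge 1$, be a sequence of finite irreducible Markov chains. Assume that $$\lim_{n \to \infty} t_{\mathrm{rel}}^{(n)} \sqrt{\frac{(1+k_n)^{5}(1+\log \Delta_n)^{3}}{\log |\mathcal{X}_{(n)}|}} = 0.$$ Then, for every $\varepsilon \in [1/2,1)$, $$\lim_{n \to \infty} \frac{k_n^{2}(1+\log \Delta_n)\, t_{\mathrm{rel}}^{(n)}}{\sqrt{t_{\mathrm{mix}}^{(n)}(\varepsilon)}} = 0.$$ In particular, for every $\varepsilon\in(0,1/2)$, $$\lim_{n \to \infty} \frac{k_n^{2}(1+\log \Delta_n)\,t_{\mathrm{rel}}^{(n)}}{\sqrt{t_{\mathrm{mix}}^{(n)}(1-\varepsilon)}} = 0,$$ and hence, if every $\mathcal{X}_{(n)}$ has non-negative Bakry--Émery curvature (i.e. $\mathrm{BE}(\mathcal{X}_{(n)},P_{(n)})\ge 0$), then a cutoff occurs for $(\mathcal{X}_{(n)})_n$, that is, $\lim_{n\to\infty} t_{\mathrm{mix}}^{(n)}(\varepsilon)/t_{\mathrm{mix}}^{(n)}(1-\varepsilon)=1$ for every $\varepsilon\in(0,1)$.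
   Context: A finite irreducible Markov chain $(\mathcal{X},P)$ (also written $(\mathcal{X},P,\pi)$) consists of a finite set $\mathcal{X}$ with $|\mathcal{X}|\ge 2$ and an irreducible stochastic matrix $P$ on $\mathcal{X}$; $\pi$ is its stationary distribution. Neither reversibility nor symmetry of the support of $P$ is assumed. Continuous-time semigroup: $\mathscr{P}_t(x,y) = e^{-t}\sum_{m\ge 0} \frac{t^m}{m!} P^m(x,y)$, $t\ge 0$. Total variation: $\|\mu_1-\mu_2\|_{\mathrm{TV}} = \frac12\sum_{x}|\mu_1(x)-\mu_2(x)|$. Mixing time: $t_{\mathrm{mix}}(\varepsilon) = \inf\{t\ge 0 : \max_{x}\|\mathscr{P}_t(x,\cdot)-\pi\|_{\mathrm{TV}}\le\varepsilon\}$, $0<\varepsilon<1$. For $f,g:\mathcal{X}\to\mathbb{R}$: $\Gamma(f,g)(x)=\frac12\sum_{y}(f(x)-f(y))(g(x)-g(y))P(x,y)$, $\Gamma(f)=\Gamma(f,f)$, $\mathcal{E}(f)=\sum_x \Gamma(f)(x)\pi(x)$, $\mathrm{Var}_\pi(f)=\sum_x (f(x)-\mathbb{E}_\pi[f])^2\pi(x)$ with $\mathbb{E}_\pi[f]=\sum_x f(x)\pi(x)$. Relaxation time: $t_{\mathrm{rel}}=\sup\{\mathrm{Var}_\pi(f)/\mathcal{E}(f) : f:\mathcal{X}\to\mathbb{R},\ \mathcal{E}(f)>0\}$. $\Delta(P)=\max\{1/P(x,y) : P(x,y)>0,\ x\ne y\}$. Directed distance: $d_P(x\to y)=\min\{k\in\mathbb{N}_0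 : P^k(x,y)>0\}$ (with $P^0=I$). $k_{(\mathcal{X},P)}=\max\{d_P(y\to x) : d_P(x\to y)=1\}$. Laplacian: $\mathcal{L}f(x)=\sum_y P(x,y)(f(y)-f(x))$. The Bakry--Émery curvature $\mathrm{BE}(\mathcal{X},P)$ is the supremum of all $\kappa$ such that $\frac12\mathcal{L}\Gamma(f)(x)\ge\Gamma(f,\mathcal{L}f)(x)+\kappa\,\Gamma(f)(x)$ for every $f:\mathcal{X}\to\mathbb{R}$ and $x\in\mathcal{X}$. For the $n$-th chain, $t_{\mathrm{mix}}^{(n)}(\cdot)$, $t_{\mathrm{rel}}^{(n)}$ are the mixing and relaxation times of $(\mathcal{X}_{(n)},P_{(n)})$, $k_n=k_{(\mathcal{X}_{(n)},P_{(n)})}$, $\Delta_n=\Delta(P_{(n)})$. A quotient with positive numerator and zero denominator is read as $+\infty$. *)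

(* Defs.v *)
From HB Require Import structures.
From mathcomp Require Import all_boot all_order all_algebra.
From mathcomp Require Import all_classical all_reals all_analysis.

Set Implicit Arguments.
Unset Strict Implicit.
Unset Printing Implicit Defensive.

Import Order.TTheory GRing.Theory Num.Theory.
Import numFieldNormedType.Exports.

Local Open Scope classical_set_scope.
Local Open Scope ring_scope.

Fixpoint kernel_pow (R : realType) (X : finType) (P : X -> X -> R) (m : nat)
    (x y : X) : R :=
  if m is m'.+1 then \sum_(z : X) P x z * kernel_pow P m' z y
  else (x == y)%:R.

(* The stationary distribution [stat] is carried with its defining properties;
   irreducibility makes it unique. *)
Record markov_chain (R : realType) := MarkovChain {
  state :> finType;
  trans : state -> state -> R;
  stat : state -> R;
  state_gt1 : (1 < #|state|)%N;
  trans_ge0 : forall x y, 0 <= trans x y;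
  trans_sum1 : forall x, \sum_(y : state) trans x y = 1;
  trans_irreducible : forall x y, exists m : nat, 0 < kernel_pow trans m x y;
  stat_ge0 : forall x, 0 <= stat x;
  stat_sum1 : \sum_(x : state) stat x = 1;
  stat_stationary : forall y, \sum_(x : state) stat x * trans x y = stat y
}.

Definition heat_kernel (R : realType) (C : markov_chain R) (t : R) (x y : C)
    : R :=
  expR (- t) *
  limn (series (fun m : nat => t ^+ m / m`!%:R * kernel_pow (@trans R C) m x y)).

Definition tv_dist (R : realType) (X : finType) (mu1 mu2 : X -> R) : R :=
  2^-1 * \sum_(x : X) `|mu1 x - mu2 x|.

(* The default value 0 of the big maximum is harmless, since total variation
   distances are nonnegative. *)
Definition tmix (R : realType) (C : markov_chain R) (eps : R) : R :=
  inf [set t : R | 0 <= t /\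
    \big[Num.max/0]_(x : C) tv_dist (heat_kernel t x) (@stat R C) <= eps].

Definition carre_du_champ (R : realType) (C : markov_chain R) (f g : C -> R)
    (x : C) : R :=
  2^-1 * \sum_(y : C) (f x - f y) * (g x - g y) * trans x y.

Definition dirichlet (R : realType) (C : markov_chain R) (f : C -> R) : R :=
  \sum_(x : C) carre_du_champ f f x * stat x.

Definition stat_mean (R : realType) (C : markov_chain R) (f : C -> R) : R :=
  \sum_(x : C) f x * stat x.

Definition stat_var (R : realType) (C : markov_chain R) (f : C -> R) : R :=
  \sum_(x : C) (f x - stat_mean f) ^+ 2 * stat x.

(* By irreducibility this set is nonempty and bounded above, so the real-valued
   [sup] is the genuine supremum. *)
Definition trel (R : realType) (C : markov_chain R) : R :=
  sup [set r : R | exists2 f : C -> R,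
    0 < dirichlet f & r = stat_var f / dirichlet f].

(* The range is nonempty and all its values are at least 1, so the default
   value 0 is never attained. *)
Definition Delta (R : realType) (C : markov_chain R) : R :=
  \big[Num.max/0]_(p : C * C | (0 < trans p.1 p.2) && (p.1 != p.2))
    (trans p.1 p.2)^-1.

Definition dir_dist (R : realType) (C : markov_chain R) (x y : C) : nat :=
  ex_minn (trans_irreducible x y).

Definition back_dist (R : realType) (C : markov_chain R) : nat :=
  (\max_(p : C * C | dir_dist p.1 p.2 == 1) dir_dist p.2 p.1)%N.

Definition laplacian (R : realType) (C : markov_chain R) (f : C -> R) (x : C)
    : R :=
  \sum_(y : C) trans x y * (f y - f x).

Definition bakry_emery (R : realType) (C : markov_chain R) : \bar R :=
  ereal_sup [set kappa%:E | kappa in [set kappa : R |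
    forall (f : C -> R) (x : C),
      2^-1 * laplacian (carre_du_champ f f) x >=
      carre_du_champ f (laplacian f) x + kappa * carre_du_champ f f x]].

(* Quotients by mixing times, which may vanish, are taken in [\bar R], where
   0^-1 = +oo (lemma [inve0]): a positive number divided by 0 is +oo. *)
Definition trel_tmix_ratio (R : realType) (C : markov_chain R) (eps : R)
    : \bar R :=
  (((back_dist C)%:R ^+ 2 * (1 + ln (Delta C)) * trel C)%:E /
   (Num.sqrt (tmix C eps))%:E)%E.

Definition has_cutoff (R : realType) (C : nat -> markov_chain R) : Prop :=
  forall eps : R, 0 < eps < 1 ->
    ((tmix (C n) eps)%:E / (tmix (C n) (1 - eps))%:E)%E @[n --> \oo] --> 1%E.

(* Main.v *)
(* Write k, Delta, T for the backward distance, the maximal inverse rate and the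
   relaxation time, and l = 1 + log Delta.

   The distance d(x -> .) is (1+k)-Lipschitz along edges, so by the Poincare
   inequality it concentrates under pi at scale (1+k) sqrt T; its heat-semigroup
   mean at time t is at most t.  Hence at a time t with d_TV(P_t(x,.), pi) <= 1-eps
   for all x, any two points are at distance O((1+k)(t + (1+k) sqrt T)).  As
   log |X| <= l * diameter, the hypothesis yields T^2 (1+k)^4 l^2 = o(t), which is
   the first claim.

   For the cutoff, let f = log (P_t(o,.)/pi) at such a time t.  The diameter bound
   makes f Lipschitz along edges with constant L = O((1+k)^2 l).  Nonnegative
   curvature gives the local Poincare inequality, so f has variance at most
   t L^2 under P_t(o,.).  Since P_t(o,.) and pi overlap by eps, f is then
   O(1 + L sqrt t) outside an event of small P_t(o,.)-probability, and the L^2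
   contraction at rate 1/T mixes the remaining mass within a further time
   O(T (1 + L sqrt t)) = o(t). *)

Require Import Defs.
From HB Require Import structures.
From mathcomp Require Import all_boot all_order all_algebra.
From mathcomp Require Import all_classical all_reals all_analysis.
From mathcomp Require Import ring lra.

Import Order.TTheory GRing.Theory Num.Theory.
Import numFieldNormedType.Exports.

Set Implicit Arguments.
Unset Strict Implicit.
Unset Printing Implicit Defensive.

Local Open Scope classical_set_scope.
Local Open Scope ring_scope.

(** * Exponential generating functions *)

Section Calculus.
Variable R : realType.

Lemma is_derive_bigsum (I : finType) (f : I -> R -> R) (df : I -> R) (t : R) :
  (forall i, is_derive t (1 : R) (f i) (df i)) ->
  is_derive t (1 : R) (fun s => \sum_i f i s) (\sum_i df i).
Proof.
move=> H; rewrite -fct_sumE.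
elim/big_ind2 : _ => // [|f1 d1 f2 d2 H1 H2]; first exact: is_derive_cst.
exact: is_deriveD.
Qed.

Lemma is_derive_continuous (f df : R -> R) :
  (forall t : R, is_derive t (1 : R) f (df t)) -> continuous f.
Proof.
move=> H t; apply/differentiable_continuous/derivable1_diffP.
by case: (H t).
Qed.

Lemma is_derive_nonincreasing (f df : R -> R) (a b : R) :
  (forall t : R, is_derive t (1 : R) f (df t)) ->
  (forall t, a < t < b -> df t <= 0) -> a <= b -> f b <= f a.
Proof.
move=> H H0 ab.
have Hd x : derivable f x 1 by case: (H x).
have Hl x : x \in `]a, b[ -> (f^`())%classic x <= 0.
  rewrite in_itv /= => xab; rewrite derive1E.
  by case: (H x) => _ ->; exact: H0.
have Hc : {within `[a, b], continuous f}.
  by apply: continuous_subspaceT; exact: is_derive_continuous H.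
have ia : a \in `[a, b] by rewrite in_itv /= lexx ab.
have ib : b \in `[a, b] by rewrite in_itv /= lexx ab.
exact: (ler0_derive1_le_cc (fun x _ => Hd x) Hl Hc ib ia ab).
Qed.

Lemma is_derive_nondecreasing (f df : R -> R) (a b : R) :
  (forall t : R, is_derive t (1 : R) f (df t)) ->
  (forall t, a < t < b -> 0 <= df t) -> a <= b -> f a <= f b.
Proof.
move=> H H0 ab; rewrite -lerN2.
apply: (@is_derive_nonincreasing (- f) (- df)) => // t /H0.
by rewrite oppr_le0.
Qed.

Lemma is_derive_reflect (f df : R -> R) (t s : R) :
  (forall u : R, is_derive u (1 : R) f (df u)) ->
  is_derive s (1 : R) (fun s => f (t - s)) (- df (t - s)).
Proof.
move=> H.
have Hts : is_derive s (1 : R) (fun s => t - s) (0 - 1).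
  exact: is_deriveB.
have := @is_derive1_comp R f (fun s => t - s) s _ _ (H (t - s)) Hts.
by rewrite sub0r mulrN1.
Qed.

(** The exponential generating function of [c], written with the same series as [heat_kernel], so
    that [heat_kernelE] holds by conversion. *)
Definition egf (c : nat -> R) (t : R) : R :=
  limn (series (fun m => t ^+ m / m`!%:R * c m)).

(** Geometric growth makes the series of [egf] converge at every time, and it survives the shift of
    coefficients that differentiation produces. *)
Definition geo_bounded (c : nat -> R) :=
  exists A B : R, forall m, `|c m| <= A * B ^+ m.

Lemma geo_bounded_cst_exp (B : R) : geo_bounded (fun m => B ^+ m).
Proof. by exists 1, `|B| => m; rewrite mul1r normrX. Qed.

Lemma geo_bounded_le1 (c : nat -> R) :
  (forall m, 0 <= c m <= 1) -> geo_bounded c.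
Proof.
move=> H; exists 1, 1 => m; rewrite expr1n mulr1.
by have /andP[c0 c1] := H m; rewrite ger0_norm.
Qed.

Lemma geo_boundedS (c : nat -> R) :
  geo_bounded c -> geo_bounded (fun m => c m.+1).
Proof. by case=> A [B H]; exists (A * B), B => m; rewrite -mulrA -exprS. Qed.

Lemma egf_is_cvg (c : nat -> R) (t : R) : geo_bounded c ->
  cvgn (series (fun m => t ^+ m / m`!%:R * c m)).
Proof.
case=> A [B H]; apply: normed_cvg.
have A0 : 0 <= A by have := H 0%N; rewrite expr0 mulr1; exact: le_trans.
apply: (@series_le_cvg _ _ (A *: exp_coeff (`|t| * `|B|))) => [m|m|m|] /=.
- exact: normr_ge0.
- by rewrite mulr_ge0 // exp_coeff_ge0 // mulr_ge0.
- rewrite normrM normrM normrX normfV normr_nat /GRing.scale /= /exp_coeff /=.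
  rewrite [leRHS](_ : _ = `|t| ^+ m / m`!%:R * (A * `|B| ^+ m)); last first.
    by rewrite exprMn -[LHS]/(A * _); ring.
  apply: ler_wpM2l; first by rewrite divr_ge0 // exprn_ge0.
  by apply: le_trans (H m) _; rewrite ler_wpM2l // -normrX ler_norm.
- by apply: is_cvg_seriesZ; exact: is_cvg_series_exp_coeff.
Qed.

Lemma egf_cvg (c : nat -> R) (t : R) : geo_bounded c ->
  series (fun m => t ^+ m / m`!%:R * c m) n @[n --> \oo] --> egf c t.
Proof. exact: egf_is_cvg. Qed.

Lemma egf_exp (B t : R) : egf (fun m => B ^+ m) t = expR (t * B).
Proof.
rewrite /egf /expR; congr (limn (series _)); apply/funext => m.
by rewrite /exp_coeff /= exprMn; ring.
Qed.

Lemma egf_derive (c : nat -> R) (t : R) : geo_bounded c ->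
  is_derive t (1 : R) (egf c) (egf (fun m => c m.+1) t).
Proof.
move=> Hc.
have E (d : nat -> R) s : (fun m => s ^+ m / m`!%:R * d m) =
    (fun i => (fun i => d i / i`!%:R) i * s ^+ i).
  by apply/funext => m; ring.
have Ed (d : nat -> R) : pseries_diffs (fun i => d i / i`!%:R) =
    (fun i => d i.+1 / i`!%:R).
  apply/funext => i; rewrite /pseries_diffs factS natrM.
  have : (i`!%:R : R) != 0 by rewrite pnatr_eq0 -lt0n fact_gt0.
  have : (i.+1%:R : R) != 0 by rewrite pnatr_eq0.
  by move=> *; field; apply/andP.
have Hs d : geo_bounded d -> cvgn (pseries (fun i => d i / i`!%:R) (`|t| + 1)).
  by move=> Hd; rewrite /pseries -E; exact: egf_is_cvg.
rewrite (_ : egf c = fun s => limn (pseries (fun i => c i / i`!%:R) s)); last first.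
  by apply/funext => s; rewrite /egf E.
have -> : egf (fun m => c m.+1) t =
    limn (pseries (pseries_diffs (fun i => c i / i`!%:R)) t).
  by rewrite Ed /egf E.
(* Termwise differentiation asks for convergence of the series and of its first two formal
   derivatives at a radius beyond [|t|]. *)
apply: (@pseries_snd_diffs _ _ (`|t| + 1)).
- exact: Hs.
- by rewrite Ed; apply: (Hs (fun m => c m.+1)); exact: geo_boundedS.
- rewrite Ed (Ed (fun m => c m.+1)).
  by apply: (Hs (fun m => c m.+2)); exact: geo_boundedS (geo_boundedS Hc).
- by rewrite [ltRHS]ger0_norm ?ltrDl // addr_ge0.
Qed.

Lemma egf0 (c : nat -> R) : egf c 0 = c 0%N.
Proof.
rewrite /egf; apply: (@lim_near_cst R^o) => //.
near=> n.
rewrite -(@prednK n); last by near: n; exists 1%N.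
rewrite /series /= big_nat_recl // expr0 fact0 divr1 mul1r.
by rewrite big1 ?addr0 // => i _; rewrite expr0n /= mul0r mul0r.
Unshelve. all: by end_near.
Qed.

Lemma cvgn_bigsum (I : finType) (u : I -> nat -> R) (l : I -> R) :
  (forall i, u i n @[n --> \oo] --> l i) ->
  (\sum_i u i n) @[n --> \oo] --> \sum_i l i.
Proof.
move=> H; rewrite -fct_sumE.
elim/big_ind2 : _ => // [|u1 l1 u2 l2 H1 H2]; first exact: cvg_cst.
exact: cvgD.
Qed.

Lemma egf_linear (I : finType) (a : I -> R) (c : I -> nat -> R) (t : R) :
  (forall i, geo_bounded (c i)) ->
  egf (fun m => \sum_i a i * c i m) t = \sum_i a i * egf (c i) t.
Proof.
move=> H; apply/cvg_lim => //.
rewrite (_ : series _ =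
  (fun n => \sum_i a i * series (fun m => t ^+ m / m`!%:R * c i m) n)).
  apply: cvgn_bigsum => i.
  by apply: cvgM; [exact: cvg_cst|exact: egf_cvg].
apply/funext => n; rewrite /series /=.
rewrite (eq_bigr (fun k => \sum_i a i * (t ^+ k / k`!%:R * c i k))); last first.
  by move=> m _; rewrite mulr_sumr; apply: eq_bigr => i _; ring.
by rewrite exchange_big /=; apply: eq_bigr => i _; rewrite mulr_sumr.
Qed.

Lemma egf_ge_term (c : nat -> R) (t : R) (d : nat) : geo_bounded c -> 0 <= t ->
  (forall m, 0 <= c m) -> t ^+ d / d`!%:R * c d <= egf c t.
Proof.
move=> Hc t0 c0.
have u0 m : 0 <= t ^+ m / m`!%:R * c m.
  by rewrite mulr_ge0 // divr_ge0 // exprn_ge0.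
have nd : nondecreasing_seq (series (fun m => t ^+ m / m`!%:R * c m)).
  by apply: nondecreasing_series => m _ _; exact: u0.
have := nondecreasing_cvgn_le nd (egf_is_cvg Hc) d.+1.
apply: le_trans; rewrite /series /= big_nat_recr //= lerDr; apply: sumr_ge0 => m _;
  exact: u0.
Qed.

(* The bound [1/(m+1) >= (1 - B^m/z)/A], whose right-hand side is nonpositive once
   [m + 1 >= A], trades the factor [t/(m+1)] between consecutive Poisson weights
   for an exponential moment. *)
Lemma egf_shift_ge (c d : nat -> R) (p A z B t : R) :
  geo_bounded c -> geo_bounded d ->
  0 < p -> 0 < A -> 0 < z -> 0 < t ->
  (forall m, 0 <= c m <= 1) -> (forall m, 0 <= d m) ->
  (forall m, p * c m <= d m.+1) ->
  0 <= B ->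
  (forall m, A <= m.+1%:R -> z <= B ^+ m) ->
  p * (t / A) * (egf c t - expR (t * B) / z) <= egf d t.
Proof.
move=> Hc Hd p0 A0 z0 t0 c01 d0 cd B0 HB.
pose u n := p * (t / A) * (series (fun m => t ^+ m / m`!%:R * c m) n -
   series (fun m => t ^+ m / m`!%:R * B ^+ m) n / z).
have cu : u n @[n --> \oo] --> p * (t / A) * (egf c t - expR (t * B) / z).
  rewrite -egf_exp.
  apply: cvgM; first exact: cvg_cst.
  apply: cvgB; first exact: egf_cvg.
  by apply: cvgM; [apply: egf_cvg; exact: geo_bounded_cst_exp|exact: cvg_cst].
rewrite -(cvg_lim _ cu) //.
apply: limr_le; first by apply/cvg_ex; eexists; exact: cu.
near=> n.
have nd : nondecreasing_seq (series (fun m => t ^+ m / m`!%:R * d m)).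
  apply: nondecreasing_series => m _ _.
  by rewrite mulr_ge0 // divr_ge0 // exprn_ge0 // ltW.
have := nondecreasing_cvgn_le nd (egf_is_cvg Hd) n.+1.
apply: le_trans.
(* Dropping the term of index 0 of [d] aligns index [m.+1] of [d] with index [m] of [c]. *)
rewrite /u /series /= big_nat_recl //= -[leLHS]add0r lerD //.
  by rewrite expr0 fact0 divr1 mul1r.
rewrite mulr_suml -sumrB mulr_sumr; apply: ler_sum => m _.
have f0 : (0 : R) < m`!%:R by rewrite ltr0n fact_gt0.
have m0 : (0 : R) < m.+1%:R by rewrite ltr0n.
have tm0 : 0 < t ^+ m by rewrite exprn_gt0.
rewrite exprS factS natrM.
have -> : p * (t / A) * (t ^+ m / m`!%:R * c m - t ^+ m / m`!%:R * B ^+ m / z) =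
  t ^+ m * t / m`!%:R * (p * ((c m - B ^+ m / z) / A)).
  by field; rewrite !gt_eqF.
have -> : t * t ^+ m / (m.+1%:R * m`!%:R) * d m.+1 =
  t ^+ m * t / m`!%:R * (d m.+1 / m.+1%:R).
  by rewrite invfM; ring.
apply: ler_wpM2l; first by rewrite ltW // divr_gt0 // mulr_gt0.
apply: (@le_trans _ _ (p * (c m / m.+1%:R))); last first.
  by rewrite mulrA ler_wpM2r // invr_ge0 ltW.
apply: ler_wpM2l; first exact: ltW.
have /andP[cm0 cm1] := c01 m.
case: (leP A m.+1%:R) => [/HB zB|mA].
  apply: (@le_trans _ _ 0); last by rewrite divr_ge0 // ltW.
  rewrite pmulr_lle0 ?invr_gt0 // subr_le0 (le_trans cm1) //.
  by rewrite ler_pdivlMr // mul1r.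
apply: (@le_trans _ _ (c m / A)).
  apply: ler_wpM2r; first by rewrite invr_ge0 ltW.
  by rewrite gerBl divr_ge0 ?exprn_ge0 // ltW.
by rewrite ler_wpM2l // lef_pV2 ?posrE // ltW.
Unshelve. all: by end_near.
Qed.

End Calculus.

(** * The heat semigroup *)

Section HeatSemigroup.
Variables (R : realType) (C : markov_chain R).
Local Notation P := (@trans R C).
Local Notation pi := (@stat R C).
Local Notation H := (@heat_kernel R C).
Local Notation L := (@laplacian R C).
Local Notation Gam := (@carre_du_champ R C).

Definition heat (t : R) (f : C -> R) (x : C) : R := \sum_y H t x y * f y.

(** * Powers of the transition matrix *)

Lemma kernel_pow_ge0 m (x y : C) : 0 <= kernel_pow P m x y.
Proof.
elim: m x => [|m IH] x /=; first exact: ler0n.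
by apply: sumr_ge0 => z _; rewrite mulr_ge0 // trans_ge0.
Qed.

Lemma kernel_pow_sum1 m (x : C) : \sum_y kernel_pow P m x y = 1.
Proof.
elim: m x => [|m IH] x /=.
  by rewrite (bigD1 x) //= eqxx big1 ?addr0 // => y /negbTE; rewrite eq_sym => ->.
rewrite exchange_big /= -[RHS](trans_sum1 x).
by apply: eq_bigr => z _; rewrite -mulr_sumr IH mulr1.
Qed.

Lemma kernel_pow_le1 m (x y : C) : kernel_pow P m x y <= 1.
Proof.
rewrite -(kernel_pow_sum1 m x) (bigD1 y) //= lerDl.
by apply: sumr_ge0 => z _; exact: kernel_pow_ge0.
Qed.

Lemma kernel_pow_geo (x y : C) : geo_bounded (fun m => kernel_pow P m x y).
Proof.
by apply: geo_bounded_le1 => m; rewrite kernel_pow_ge0 kernel_pow_le1.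
Qed.

Lemma kernel_powD m n (x y : C) :
  kernel_pow P (m + n) x y = \sum_z kernel_pow P m x z * kernel_pow P n z y.
Proof.
elim: m x => [|m IH] x.
  rewrite add0n (bigD1 x) //= eqxx mul1r big1 ?addr0 // => z /negbTE.
  by rewrite eq_sym => ->; rewrite mul0r.
rewrite addSn /=.
transitivity (\sum_z \sum_w P x z * (kernel_pow P m z w * kernel_pow P n w y)).
  by apply: eq_bigr => z _; rewrite IH mulr_sumr.
rewrite exchange_big /=; apply: eq_bigr => w _; rewrite mulr_suml.
by apply: eq_bigr => z _; rewrite mulrA.
Qed.

Lemma kernel_powSr m (x y : C) :
  kernel_pow P m.+1 x y = \sum_z kernel_pow P m x z * P z y.
Proof.
rewrite -addn1 kernel_powD; apply: eq_bigr => z _; congr (_ * _) => /=.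
rewrite (bigD1 y) //= eqxx mulr1 big1 ?addr0 // => w /negbTE ->.
by rewrite mulr0.
Qed.

Lemma kernel_powS_gt0 m (x y : C) : 0 < kernel_pow P m.+1 x y ->
  exists2 z, 0 < P x z & 0 < kernel_pow P m z y.
Proof.
move=> h; have /existsP[z /andP[Pz Kz]] :
    [exists z, (0 < P x z) && (0 < kernel_pow P m z y)]; last by exists z.
apply: contraLR h; rewrite negb_exists -leNgt => /forallP Hz.
rewrite /= big1 // => z _; have := Hz z; rewrite negb_and -!leNgt => /orP[] h.
  have -> : P x z = 0 by apply/eqP; rewrite eq_le h trans_ge0.
  by rewrite mul0r.
have -> : kernel_pow P m z y = 0 by apply/eqP; rewrite eq_le h kernel_pow_ge0.
by rewrite mulr0.
Qed.

Lemma laplacianE (f : C -> R) x : L f x = \sum_y P x y * f y - f x.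
Proof.
rewrite /laplacian -[in RHS](mul1r (f x)) -(trans_sum1 x) mulr_suml -sumrB.
by apply: eq_bigr => y _; ring.
Qed.

(** * The heat kernel, its differential equations and the semigroup law *)

Lemma heat_kernelE t x y :
  H t x y = expR (- t) * egf (fun m => kernel_pow P m x y) t.
Proof. by []. Qed.

Lemma heat_kernel0 x y : H 0 x y = (x == y)%:R.
Proof. by rewrite heat_kernelE egf0 oppr0 expR0 mul1r. Qed.

Lemma heat_kernel_ge_term t x y d : 0 <= t ->
  expR (- t) * (t ^+ d / d`!%:R * kernel_pow P d x y) <= H t x y.
Proof.
move=> t0; rewrite heat_kernelE ler_wpM2l ?expR_ge0 //.
apply: (egf_ge_term (c := fun m => kernel_pow P m x y)) => //.
  exact: kernel_pow_geo.
by move=> m; exact: kernel_pow_ge0.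
Qed.

Lemma heat_kernel_ge0 t x y : 0 <= t -> 0 <= H t x y.
Proof.
move=> t0; apply: le_trans (heat_kernel_ge_term x y 0 t0).
by rewrite expr0 fact0 divr1 mul1r mulr_ge0 ?expR_ge0 ?kernel_pow_ge0.
Qed.

Lemma heat_kernel_gt0 t x y : 0 < t -> 0 < H t x y.
Proof.
move=> t0; have [d Pd] := trans_irreducible x y.
apply: lt_le_trans (heat_kernel_ge_term x y d (ltW t0)).
by rewrite !mulr_gt0 ?expR_gt0 ?exprn_gt0 // invr_gt0 ltr0n fact_gt0.
Qed.

Lemma is_derive_expN (t : R) :
  is_derive t (1 : R) (fun s : R => expR (- s)) (- expR (- t)).
Proof.
have Hn : is_derive t (1 : R) (fun s : R => - s) (-1) by exact: is_deriveN.
have := @is_derive1_comp R expR (fun s => - s) t _ _ (is_derive_expR (- t)) Hn.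
by rewrite mulrN1.
Qed.

Lemma is_derive_prod (f g : R -> R) (df dg t : R) :
  is_derive t (1 : R) f df -> is_derive t (1 : R) g dg ->
  is_derive t (1 : R) (fun s => f s * g s) (df * g t + f t * dg).
Proof.
move=> Hf Hg; have Hfg : is_derive t (1 : R) (fun s => f s * g s) _ := is_deriveM Hf Hg.
by apply: (is_derive_eq Hfg); rewrite /GRing.scale /= addrC [g t * _]mulrC.
Qed.

Lemma is_derive_cstM (a : R) (f : R -> R) (df t : R) :
  is_derive t (1 : R) f df -> is_derive t (1 : R) (fun s => a * f s) (a * df).
Proof.
move=> Hf; apply: (is_derive_eq (is_derive_prod (is_derive_cst a t (1 : R)) Hf)).
by rewrite mul0r add0r.
Qed.

Lemma heat_kernel_derive t x y : is_derive t (1 : R) (fun s => H s x y)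
  (expR (- t) * egf (fun m => kernel_pow P m.+1 x y) t - H t x y).
Proof.
have E := egf_derive t (kernel_pow_geo x y).
apply: (is_derive_eq (is_derive_prod (is_derive_expN t) E)).
by rewrite heat_kernelE; ring.
Qed.

(** Kolmogorov's forward equation: the shifted power is split at its last step. *)
Lemma heat_kernel_derive_fwd t x y : is_derive t (1 : R) (fun s => H s x y)
  (\sum_z H t x z * P z y - H t x y).
Proof.
apply: (is_derive_eq (heat_kernel_derive t x y)); congr (_ - _).
rewrite (_ : (fun m => _) = fun m => \sum_z P z y * kernel_pow P m x z); last first.
  by apply/funext => m; rewrite kernel_powSr; apply: eq_bigr => z _; rewrite mulrC.
rewrite egf_linear; last by move=> z; exact: kernel_pow_geo.
by rewrite mulr_sumr; apply: eq_bigr => z _; rewrite heat_kernelE; ring.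
Qed.

(** Kolmogorov's backward equation: the shifted power is split at its first step. *)
Lemma heat_kernel_derive_bwd t x y : is_derive t (1 : R) (fun s => H s x y)
  (\sum_z P x z * H t z y - H t x y).
Proof.
apply: (is_derive_eq (heat_kernel_derive t x y)); congr (_ - _).
rewrite (_ : (fun m => _) = fun m => \sum_z P x z * kernel_pow P m z y); last first.
  by apply/funext => m.
rewrite egf_linear; last by move=> z; exact: kernel_pow_geo.
by rewrite mulr_sumr; apply: eq_bigr => z _; rewrite heat_kernelE; ring.
Qed.

Lemma heat_derive t f x :
  is_derive t (1 : R) (fun s => heat s f x) (L (heat t f) x).
Proof.
have Hd : is_derive t (1 : R) (fun s => heat s f x)
    (\sum_y (\sum_z P x z * H t z y - H t x y) * f y).
  apply: is_derive_bigsum => y.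
  apply: (is_derive_eq (is_derive_prod (heat_kernel_derive_bwd t x y)
    (is_derive_cst (f y) t (1 : R)))).
  by rewrite mulr0 addr0.
apply: (is_derive_eq Hd); rewrite laplacianE /heat.
rewrite (eq_bigr (fun y => (\sum_z P x z * H t z y) * f y - H t x y * f y)); last first.
  by move=> y _; ring.
rewrite sumrB; congr (_ - _).
rewrite [RHS](eq_bigr (fun z => \sum_y P x z * (H t z y * f y))); last first.
  by move=> z _; rewrite mulr_sumr.
rewrite exchange_big /=; apply: eq_bigr => y _.
by rewrite mulr_suml; apply: eq_bigr => z _; ring.
Qed.

(** Product rule, with the forward equation moving the generator onto [g t]. The interpolation
    arguments along the semigroup differentiate through this lemma. *)
Lemma heat_derive_path (g : R -> C -> R) (dg : C -> R) t x :
  (forall y, is_derive t (1 : R) (fun s => g s y) (dg y)) ->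
  is_derive t (1 : R) (fun s => heat s (g s) x)
    (heat t (fun y => L (g t) y + dg y) x).
Proof.
move=> Hg.
have Hd : is_derive t (1 : R) (fun s => heat s (g s) x)
    (\sum_y ((\sum_z H t x z * P z y - H t x y) * g t y + H t x y * dg y)).
  apply: is_derive_bigsum => y.
  exact: is_derive_prod (heat_kernel_derive_fwd t x y) (Hg y).
apply: (is_derive_eq Hd); rewrite /heat.
rewrite [RHS](eq_bigr (fun y => (\sum_z H t x y * (P y z * g t z)) +
   (- (H t x y * g t y) + H t x y * dg y))); last first.
  by move=> y _; rewrite laplacianE -mulr_sumr; ring.
rewrite [LHS](eq_bigr (fun y => (\sum_z H t x z * (P z y * g t y)) +
   (- (H t x y * g t y) + H t x y * dg y))); last first.
  move=> y _; rewrite mulrBl mulr_suml addrA; congr (_ - _ + _).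
  by apply: eq_bigr => z _; ring.
rewrite !big_split /=; congr (_ + _).
by rewrite exchange_big.
Qed.

Lemma heat0 f x : heat 0 f x = f x.
Proof.
rewrite /heat (bigD1 x) //= heat_kernel0 eqxx mul1r big1 ?addr0 // => y /negbTE.
by rewrite eq_sym heat_kernel0 => ->; rewrite mul0r.
Qed.

Lemma heat_reflect_derive t s f y :
  is_derive s (1 : R) (fun s => heat (t - s) f y) (- L (heat (t - s) f) y).
Proof.
exact: (is_derive_reflect t s (fun u => heat_derive u f y)).
Qed.

(** The path [heat u (heat (s + t - u) f)] has zero derivative in [u]; its values at [u = 0] and
    [u = s] are the two sides. *)
Lemma heat_add s t f x : heat (s + t) f x = heat s (heat t f) x.
Proof.
pose F u := heat u (heat (s + t - u) f) x.
have dF u : is_derive u (1 : R) F 0.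
  apply: (is_derive_eq
    (heat_derive_path x (fun y => heat_reflect_derive (s + t) u f y)));
      rewrite /heat big1 // => y _.
  by rewrite subrr mulr0.
have := is_derive_0_is_cst 0 s dF.
by rewrite /F heat0 subr0 addrAC subrr add0r.
Qed.

Lemma heat_kernel_sum1 t x : \sum_y H t x y = 1.
Proof.
pose F u := heat u (fun=> 1) x.
have dF u : is_derive u (1 : R) F 0.
  apply: (is_derive_eq
    (heat_derive_path x (fun y : C => is_derive_cst (1 : R) u (1 : R))));
      rewrite /heat big1 // => y _.
  by rewrite laplacianE addr0 (eq_bigr (P y)) ?trans_sum1 ?subrr ?mulr0 // => z;
    rewrite mulr1.
have := is_derive_0_is_cst t 0 dF; rewrite /F heat0 /heat => <-.
by apply: eq_bigr => y _; rewrite mulr1.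
Qed.

Lemma stat_laplacian f : \sum_x pi x * L f x = 0.
Proof.
rewrite (eq_bigr (fun x => (\sum_y pi x * P x y * f y) - pi x * f x)); last first.
  move=> x _; rewrite laplacianE mulrBr mulr_sumr; congr (_ - _).
  by apply: eq_bigr => y _; rewrite mulrA.
rewrite sumrB exchange_big /=; apply/eqP; rewrite subr_eq0; apply/eqP.
by apply: eq_bigr => y _; rewrite -mulr_suml stat_stationary.
Qed.

Lemma stat_heat t f : \sum_x pi x * heat t f x = \sum_x pi x * f x.
Proof.
pose F u := \sum_x pi x * heat u f x.
have dF u : is_derive u (1 : R) F 0.
  rewrite -(stat_laplacian (heat u f)).
  apply: is_derive_bigsum => x; apply: is_derive_cstM; exact: heat_derive.
have := is_derive_0_is_cst t 0 dF; rewrite /F => ->.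
by apply: eq_bigr => x _; rewrite heat0.
Qed.

Lemma heat_ge0 t f x : 0 <= t -> (forall y, 0 <= f y) -> 0 <= heat t f x.
Proof.
by move=> t0 f0; apply: sumr_ge0 => y _; rewrite mulr_ge0 // heat_kernel_ge0.
Qed.

Lemma heat_mono t f g x : 0 <= t -> (forall y, f y <= g y) ->
  heat t f x <= heat t g x.
Proof.
by move=> t0 fg; apply: ler_sum => y _; rewrite ler_wpM2l // heat_kernel_ge0.
Qed.

Lemma heat_cst t a x : heat t (fun=> a) x = a.
Proof. by rewrite /heat -mulr_suml heat_kernel_sum1 mul1r. Qed.

Lemma heatZ t a f x : heat t (fun y => a * f y) x = a * heat t f x.
Proof. by rewrite /heat mulr_sumr; apply: eq_bigr => y _; rewrite mulrCA. Qed.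

Lemma laplacian_sqr f x :
  L (fun y => f y ^+ 2) x = 2 * Gam f f x + 2 * (f x * L f x).
Proof.
rewrite /laplacian /carre_du_champ !mulr_sumr -big_split /=.
by apply: eq_bigr => y _; field.
Qed.

Lemma carre_du_champ_ge0 f x : 0 <= Gam f f x.
Proof.
rewrite mulr_ge0 ?invr_ge0 // sumr_ge0 // => y _.
by rewrite mulr_ge0 ?trans_ge0 // -expr2 sqr_ge0.
Qed.

Lemma is_derive_carre (g : R -> C -> R) (dg : C -> R) t x :
  (forall y, is_derive t (1 : R) (fun s => g s y) (dg y)) ->
  is_derive t (1 : R) (fun s => Gam (g s) (g s) x) (2 * Gam (g t) dg x).
Proof.
move=> Hg.
have Hd : is_derive t (1 : R) (fun s => Gam (g s) (g s) x)
   (2^-1 * \sum_y ((dg x - dg y) * (g t x - g t y) + (g t x - g t y) * (dg x - dg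
     y)) * P x y).
  apply: is_derive_cstM; apply: is_derive_bigsum => y.
  have Hxy : is_derive t (1 : R) (fun s => g s x - g s y) (dg x - dg y).
    exact: (is_deriveB (Hg x) (Hg y)).
  apply: (is_derive_eq (is_derive_prod (is_derive_prod Hxy Hxy)
    (is_derive_cst (P x y) t (1 : R)))).
  by rewrite mulr0 addr0.
apply: (is_derive_eq Hd); rewrite /carre_du_champ mulrCA; congr (_ * _).
by rewrite mulr_sumr; apply: eq_bigr => y _; ring.
Qed.

Lemma carre_du_champNr f g x : Gam f (fun y => - g y) x = - Gam f g x.
Proof.
rewrite /carre_du_champ -mulrN -sumrN; congr (_ * _).
by apply: eq_bigr => y _; ring.
Qed.

End HeatSemigroup.

(** * Poincare inequalities *)

Section Relaxation.
Variables (R : realType) (C : markov_chain R).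
Local Notation P := (@trans R C).
Local Notation pi := (@stat R C).
Local Notation H := (@heat_kernel R C).
Local Notation L := (@laplacian R C).
Local Notation Gam := (@carre_du_champ R C).


(** Some state has positive mass, [pi] is invariant under the semigroup, and the heat kernel at time
    1 is positive everywhere. *)
Lemma stat_gt0 y : 0 < pi y.
Proof.
have [x px] : exists x, 0 < pi x.
  apply/existsP; apply: contraT; rewrite negb_exists => /forallP Hx.
  have := stat_sum1 C; rewrite big1 => [/eqP|x _]; first by rewrite eq_sym oner_eq0.
  by apply/eqP; rewrite eq_le stat_ge0 andbT leNgt Hx.
have := stat_heat 1 (fun z => (z == y)%:R).
rewrite [RHS](bigD1 y) //= eqxx mulr1 [X in _ = _ + X]big1 ?addr0; last first.
  by move=> z /negbTE ->; rewrite mulr0.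
move=> <-; rewrite (bigD1 x) //= ltr_wpDr //.
  by apply: sumr_ge0 => z _; rewrite mulr_ge0 ?stat_ge0 ?heat_ge0.
rewrite mulr_gt0 // /heat (bigD1 y) //= eqxx mulr1 ltr_wpDr ?heat_kernel_gt0 //.
by apply: sumr_ge0 => z _; rewrite mulr_ge0 ?heat_kernel_ge0.
Qed.

(** * Energy, variance and the Poincare constant *)

Lemma dirichlet_ge0 f : 0 <= dirichlet (C := C) f.
Proof.
by apply: sumr_ge0 => x _; rewrite mulr_ge0 ?stat_ge0 ?carre_du_champ_ge0.
Qed.

Lemma stat_var_ge0 f : 0 <= stat_var (C := C) f.
Proof. by apply: sumr_ge0 => x _; rewrite mulr_ge0 ?stat_ge0 ?sqr_ge0. Qed.

Lemma stat_var_osc_le f (a : R) : (forall x y, `|f x - f y| <= a) ->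
  stat_var (C := C) f <= a ^+ 2.
Proof.
move=> Ha; rewrite -[leRHS]mulr1 -(stat_sum1 C) mulr_sumr.
apply: ler_sum => x _; rewrite ler_wpM2r ?stat_ge0 //.
have -> : f x - stat_mean f = \sum_y (f x - f y) * pi y.
  rewrite -[f x in LHS]mulr1 -(stat_sum1 C) mulr_sumr /stat_mean -sumrB.
  by apply: eq_bigr => y _; rewrite mulrBl.
have a0 : 0 <= a := le_trans (normr_ge0 _) (Ha x x).
rewrite -real_normK ?num_real // lerXn2r ?nnegrE //.
apply: le_trans (ler_norm_sum _ _ _) _.
rewrite -[leRHS]mulr1 -(stat_sum1 C) mulr_sumr; apply: ler_sum => y _.
by rewrite normrM (ger0_norm (stat_ge0 y)) ler_wpM2r ?stat_ge0.
Qed.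

Lemma edge_sqr_le_dirichlet f x y :
  pi x * P x y * (f x - f y) ^+ 2 <= 2 * dirichlet f.
Proof.
rewrite /dirichlet mulr_sumr (bigD1 x) //= -[leLHS]addr0 lerD //; last first.
  apply: sumr_ge0 => z _.
  by rewrite mulr_ge0 // mulr_ge0 ?stat_ge0 ?carre_du_champ_ge0.
rewrite /carre_du_champ -[X in _ <= 2 * X]mulrA mulVKf ?pnatr_eq0 // mulr_suml
  (bigD1 y) //=.
rewrite -[leLHS]addr0 lerD //; first by rewrite le_eqVlt; apply/orP; left; apply/eqP;
  ring.
apply: sumr_ge0 => z _.
by rewrite mulr_ge0 ?stat_ge0 // mulr_ge0 ?trans_ge0 // -expr2 sqr_ge0.
Qed.

Lemma path_lipschitz (f : C -> R) (b : R) m x y : 0 <= b ->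
  (forall u v, 0 < P u v -> u != v -> f u - f v <= b) ->
  0 < kernel_pow P m x y -> f x - f y <= m%:R * b.
Proof.
move=> b0 Hb; elim: m x => [|m IH] x /=.
  by case: eqP => [->|]; rewrite ?ltxx // subrr mul0r.
case/kernel_powS_gt0 => z Pz Kz.
have h1 : f x - f z <= b.
  by have [->|xz] := eqVneq x z; [rewrite subrr|exact: Hb].
have h2 := IH z Kz; rewrite mulrSr mulrDl mul1r; lra.
Qed.

(** The size of the constant is irrelevant: its existence bounds the set defining [trel]. The energy
    controls the increment of [f] on each edge, and any two states are joined by a path. *)
Lemma poincare_finite : exists K, forall f, stat_var (C := C) f <= K * dirichlet f.
Proof.
(* Sums stand in for maxima: [S] dominates the inverse weight of every edge and [M] every directed
   distance. *)
pose S := \sum_(p : C * C) (if 0 < P p.1 p.2 then (pi p.1 * P p.1 p.2)^-1 else 0).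
pose M := (\sum_(p : C * C) dir_dist p.1 p.2)%N.
have S0 (p : C * C) : 0 <= (if 0 < P p.1 p.2 then (pi p.1 * P p.1 p.2)^-1 else 0).
  by case: ifP => // h; rewrite invr_ge0 mulr_ge0 ?stat_ge0 // ltW.
have HS x y : 0 < P x y -> (pi x * P x y)^-1 <= S.
  move=> h; rewrite /S (bigD1 (x, y)) //= h lerDl; exact: sumr_ge0.
exists (M%:R ^+ 2 * (S * 2)) => f.
have E0 := dirichlet_ge0 f.
have SE0 : 0 <= S * 2 * dirichlet f by rewrite !mulr_ge0 // sumr_ge0.
pose b := Num.sqrt (S * 2 * dirichlet f).
have Hb u v : 0 < P u v -> `|f u - f v| <= b.
  move=> Puv; rewrite -sqrtr_sqr ler_sqrt //.
  have pp : 0 < pi u * P u v by rewrite mulr_gt0 ?stat_gt0.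
  have := edge_sqr_le_dirichlet f u v.
  rewrite -ler_pdivlMl // => /le_trans; apply.
  by rewrite -mulrA ler_wpM2r ?HS // mulr_ge0.
have b0 : 0 <= b by exact: sqrtr_ge0.
have Hd x y : f x - f y <= M%:R * b.
  have hd : 0 < kernel_pow P (dir_dist x y) x y.
    by rewrite /dir_dist; case: ex_minnP.
  have := path_lipschitz b0 (fun u v h _ => le_trans (ler_norm _) (Hb u v h)) hd.
  move=> /le_trans; apply; rewrite ler_wpM2r // ler_nat /M (bigD1 (x, y)) //=.
  exact: leq_addr.
rewrite -mulrA -(sqr_sqrtr SE0) -exprMn; apply: stat_var_osc_le => x y.
by rewrite ler_norml Hd andbT lerNl opprB Hd.
Qed.

Lemma stat_var_eq0 f x : stat_var (C := C) f = 0 -> f x = stat_mean f.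
Proof.
move/psumr_eq0P => h; have := h (fun x _ => mulr_ge0 (sqr_ge0 _) (stat_ge0 x)) x isT.
move/eqP; rewrite mulf_eq0 [pi x == 0]gt_eqF ?stat_gt0 // orbF sqrf_eq0 subr_eq0.
by move/eqP.
Qed.

Lemma exists_dirichlet_gt0 : exists f, 0 < dirichlet (C := C) f.
Proof.
have [K HK] := poincare_finite.
have /card_gt1P[x [y [_ _ xy]]] := state_gt1 C.
exists (fun z => (z == x)%:R); rewrite lt_neqAle dirichlet_ge0 andbT.
apply/eqP => E0; have V0 : stat_var (C := C) (fun z => (z == x)%:R) = 0.
  by apply/eqP; rewrite eq_le stat_var_ge0 andbT (le_trans (HK _)) // -E0 mulr0.
have := stat_var_eq0 x V0; rewrite -(stat_var_eq0 y V0) eqxx.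
by rewrite eq_sym (negbTE xy) => /eqP; rewrite oner_eq0.
Qed.

Lemma trel_has_sup : has_sup [set r : R | exists2 f : C -> R,
    0 < dirichlet (C := C) f & r = stat_var f / dirichlet (C := C) f].
Proof.
split; first by have [f f0] := exists_dirichlet_gt0;
  exists (stat_var f / dirichlet f); exists f.
have [K HK] := poincare_finite; exists K => _ [f f0 ->].
by rewrite ler_pdivrMr.
Qed.

(** For positive energy this is the definition of [trel]; for zero energy [poincare_finite] forces
    the variance to vanish. *)
Lemma poincare (f : C -> R) : stat_var f <= trel C * dirichlet f.
Proof.
have [f0|] := ltP 0 (dirichlet f).
  rewrite -ler_pdivrMr //; apply: sup_upper_bound; first exact: trel_has_sup.
  by exists f.
move=> f0; have {f0}E0 : dirichlet f = 0.
  by apply/eqP; rewrite eq_le f0 dirichlet_ge0.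
by have [K /(_ f)] := poincare_finite; rewrite E0 !mulr0.
Qed.

Lemma stat_meanB_var f (a : R) : stat_mean (C := C) f = a ->
  stat_var f = \sum_x (f x - a) ^+ 2 * pi x.
Proof. by move=> <-. Qed.

(** For centred values, (a - b)^2 <= 2 a^2 + 2 b^2; stationarity turns the average over the endpoint
    of a step into an average under [pi]. *)
Lemma dirichlet_le_var (f : C -> R) : dirichlet f <= 2 * stat_var (C := C) f.
Proof.
pose g x := f x - stat_mean f.
rewrite /dirichlet.
apply: (@le_trans _ _ (\sum_x (g x ^+ 2 * pi x + \sum_y pi x * P x y * g y ^+ 2))).
  apply: ler_sum => x _.
  rewrite -[g x ^+ 2 * pi x]mulr1 -(trans_sum1 x) mulr_sumr -big_split /=.
  rewrite /carre_du_champ mulr_sumr mulr_suml; apply: ler_sum => y _.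
  have h : 2^-1 * ((f x - f y) * (f x - f y)) <= g x ^+ 2 + g y ^+ 2.
    have -> : f x - f y = g x - g y by rewrite /g; ring.
    by have := sqr_ge0 (g x + g y); lra.
  have := ler_wpM2l (mulr_ge0 (stat_ge0 x) (trans_ge0 x y)) h; lra.
rewrite big_split /= exchange_big /=.
have -> : \sum_y \sum_x pi x * P x y * g y ^+ 2 = stat_var f.
  by apply: eq_bigr => y _; rewrite -mulr_suml stat_stationary mulrC.
by rewrite -/(stat_var f); lra.
Qed.

(** Chaining [poincare] with [dirichlet_le_var] at one function of positive energy. The bound later
    absorbs additive constants. *)
Lemma trel_ge_half : 2^-1 <= trel C.
Proof.
have [f f0] := exists_dirichlet_gt0.
have := poincare f; have := dirichlet_le_var f.
move=> h1 h2; have : dirichlet f <= 2 * trel C * dirichlet f by lra.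
by rewrite -ler_pdivrMr // divff ?gt_eqF // => h3; lra.
Qed.

Lemma trel_gt0 : 0 < trel C.
Proof. by apply: lt_le_trans trel_ge_half; rewrite invr_gt0. Qed.

Lemma stat_mean_heat s f : stat_mean (heat s f) = stat_mean (C := C) f.
Proof.
rewrite /stat_mean (eq_bigr (fun x => pi x * heat s f x)) => [|x _].
  by rewrite stat_heat; apply: eq_bigr => x _; rewrite mulrC.
by rewrite mulrC.
Qed.

(** The stationary mean of the Laplacian of a square vanishes, so by [laplacian_sqr] the mean of 2 g
    L g is minus twice the energy of g. *)
Lemma stat_var_heat_derive (f : C -> R) t :
  is_derive t (1 : R) (fun s => stat_var (heat s f)) (- 2 * dirichlet (heat t f)).
Proof.
rewrite (_ : (fun s => _) =
   (fun s => \sum_x pi x * ((heat s f x - stat_mean f) * (heat s f x - stat_mean f)))).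
  have D : is_derive t (1 : R)
    (fun s => \sum_x pi x * ((heat s f x - stat_mean f) * (heat s f x - stat_mean f)))
    (\sum_x pi x * (L (heat t f) x * (heat t f x - stat_mean f) +
       (heat t f x - stat_mean f) * L (heat t f) x)).
    apply: is_derive_bigsum => x; apply: is_derive_cstM.
    have Hx : is_derive t (1 : R) (fun s => heat s f x - stat_mean f) (L (heat t f) x).
      apply: (is_derive_eq (is_deriveB (heat_derive t f x)
        (is_derive_cst (stat_mean f) t (1 : R)))).
      by rewrite subr0.
    exact: is_derive_prod.
  apply: (is_derive_eq D).
  have h := stat_laplacian (fun y => heat t f y ^+ 2).
  rewrite (eq_bigr (fun x => 2 * (Gam (heat t f) (heat t f) x * pi x) +
    2 * (pi x * (heat t f x * L (heat t f) x)))) in h; last first.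
    by move=> x _; rewrite laplacian_sqr; ring.
  rewrite big_split /= -!mulr_sumr -/(dirichlet _) in h.
  rewrite (eq_bigr (fun x => 2 * (pi x * (heat t f x * L (heat t f) x)) -
    2 * stat_mean f * (pi x * L (heat t f) x))); last by move=> x _; ring.
  rewrite sumrB -!mulr_sumr stat_laplacian; lra.
apply/funext => s; rewrite (stat_meanB_var (stat_mean_heat s f)); apply: eq_bigr => x _.
by rewrite expr2 mulrC.
Qed.

(** Gronwall's argument: by the Poincare inequality exp(2 s / [trel C]) times the variance at time s
    is nonincreasing. *)
Lemma stat_var_heat_le (f : C -> R) t : 0 <= t ->
  stat_var (heat t f) <= expR (- (2 * t / trel C)) * stat_var f.
Proof.
move=> t0; pose F s := expR (2 / trel C * s) * stat_var (heat s f).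
have D s : is_derive s (1 : R) F
    ((2 / trel C) * expR (2 / trel C * s) * stat_var (heat s f) +
     expR (2 / trel C * s) * (- 2 * dirichlet (heat s f))).
  apply: is_derive_prod; last exact: stat_var_heat_derive.
  have h : is_derive s (1 : R) (fun s => 2 / trel C * s) (2 / trel C).
    apply: (is_derive_eq (is_derive_cstM (2 / trel C) (is_derive_id s (1 : R)))).
    by rewrite mulr1.
  apply: (is_derive_eq (is_derive1_comp (is_derive_expR _) h)).
  by rewrite mulrC.
have : F t <= F 0.
  apply: (is_derive_nonincreasing D) => // s _.
  have h : 2 / trel C * stat_var (heat s f) <= 2 * dirichlet (heat s f).
    rewrite mulrAC ler_pdivrMr ?trel_gt0 // -mulrA ler_pM2l // mulrC.
    exact: poincare.
  have := ler_wpM2l (expR_ge0 (2 / trel C * s)) h; lra.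
rewrite /F mulr0 expR0 mul1r expRN (_ : heat 0 f = f); last first.
  by apply/funext => x; rewrite heat0.
rewrite mulrC -ler_pdivlMr ?expR_gt0 // => /le_trans; apply.
by rewrite mulrC mulrAC.
Qed.

(** The definition of a supremum only supplies admissible constants above [- e] for each positive
    [e]; the inequality with constant 0 follows by letting [e] tend to 0. *)
Lemma bakry_emery_ge0 : (0 <= bakry_emery C)%E ->
  forall f x, 2 * Gam f (L f) x <= L (Gam f f) x.
Proof.
move=> be f x.
suff h (e : R) : 0 < e -> Gam f (L f) x <= 2^-1 * L (Gam f f) x + e * Gam f f x.
  have G0 := carre_du_champ_ge0 f x.
  suff : Gam f (L f) x <= 2^-1 * L (Gam f f) x by lra.
  apply/ler_addgt0Pr => e e0.
  (* The denominator [Gam f f x + 1] makes the error term at most [e], also when [Gam f f x]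
     vanishes. *)
  have := h (e / (Gam f f x + 1)); rewrite divr_gt0 ?ltr_wpDl // => /(_ isT) /le_trans.
  apply; rewrite lerD2l mulrAC ler_pdivrMr ?ltr_wpDl //.
  by rewrite ler_wpM2l ?lerDl // ltW.
move=> e0.
have : ((- e)%:E < bakry_emery C)%E by apply: lt_le_trans be; rewrite lte_fin oppr_lt0.
move=> /ereal_sup_gt[_ [k /(_ f x) hk <-]]; rewrite lte_fin => ke.
have := ler_wpM2r (carre_du_champ_ge0 f x) (ltW ke); lra.
Qed.

(** * Gradient bound and local Poincare inequality under nonnegative curvature *)

Section NonnegativeCurvature.
Hypothesis be : (0 <= bakry_emery C)%E.

(* Semigroup interpolation: [s |-> P_s (Gamma (P_(t-s) f))] is nondecreasing. *)
Lemma carre_du_champ_heat_le (f : C -> R) t x : 0 <= t ->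
  Gam (heat t f) (heat t f) x <= heat t (Gam f f) x.
Proof.
move=> t0; pose psi s := heat s (Gam (heat (t - s) f) (heat (t - s) f)) x.
have D s : is_derive s (1 : R) psi _ :=
  heat_derive_path x (fun y => is_derive_carre y (heat_reflect_derive t s f)).
have : psi 0 <= psi t.
  apply: (is_derive_nondecreasing D) => // s /andP[s0 st].
  apply: heat_ge0 => [|y]; first exact: ltW.
  by rewrite carre_du_champNr mulrN subr_ge0; exact: bakry_emery_ge0.
rewrite /psi subr0 subrr heat0 (_ : heat 0 f = f) //.
by apply/funext => y; rewrite heat0.
Qed.

(** The derivative in s of P_s ((P_(t-s) f)^2) is 2 P_s (Gamma (P_(t-s) f)), which the gradient
    bound and the semigroup law bound by 2 P_t (Gamma f). *)
Lemma local_poincare (f : C -> R) t x : 0 <= t ->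
  heat t (fun y => f y ^+ 2) x - heat t f x ^+ 2 <= 2 * t * heat t (Gam f f) x.
Proof.
move=> t0; set M := heat t (Gam f f) x.
pose phi s := heat s (fun y => heat (t - s) f y * heat (t - s) f y) x - 2 * M * s.
have D s : is_derive s (1 : R) phi (_ - 2 * M * 1) := is_deriveB
  (heat_derive_path x (fun y =>
     is_derive_prod (heat_reflect_derive t s f y) (heat_reflect_derive t s f y)))
  (is_derive_cstM (2 * M) (is_derive_id s (1 : R))).
have : phi t <= phi 0.
  apply: (is_derive_nonincreasing D) => // s /andP[s0 st].
  rewrite subr_le0 mulr1 /M -[in leRHS](subrKC s t) heat_add -heatZ.
  apply: heat_mono => [|y]; first exact: ltW.
  have := laplacian_sqr (heat (t - s) f) y.
  rewrite (_ : (fun y => _ ^+ 2) = fun y => heat (t - s) f y * heat (t - s) f y) //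
    => ->.
  have := @carre_du_champ_heat_le f (t - s) y; rewrite subr_ge0 (ltW st) => /(_ isT).
  lra.
rewrite /phi subrr subr0 heat0 mulr0 subr0 (_ : (fun y => _) = fun y => f y ^+ 2).
  by rewrite -expr2; lra.
by apply/funext => y; rewrite heat0.
Qed.

End NonnegativeCurvature.

End Relaxation.

(** * Directed distances *)

Section Geometry.
Variables (R : realType) (C : markov_chain R).
Local Notation P := (@trans R C).
Local Notation pi := (@stat R C).
Local Notation H := (@heat_kernel R C).
Local Notation L := (@laplacian R C).
Local Notation Gam := (@carre_du_champ R C).
Local Notation ell := (1 + ln (Delta C)).
Local Notation k1 := (1 + (back_dist C)%:R : R).

Implicit Types (x y z u v : C) (f : C -> R).

(** * Markov's inequality and total variation on events *)

Lemma sum_pred_le (p q : pred C) (nu : C -> R) : (forall x, 0 <= nu x) ->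
  (forall x, p x -> q x) -> \sum_(x | p x) nu x <= \sum_(x | q x) nu x.
Proof.
move=> nu0 pq; rewrite big_mkcond [leRHS]big_mkcond /=; apply: ler_sum => x _.
by case: ifP => [/pq ->//|_]; case: ifP.
Qed.

Lemma markov_sum (g nu : C -> R) (a : R) : (forall x, 0 <= nu x) ->
  (forall x, 0 <= g x) -> a * \sum_(x | a <= g x) nu x <= \sum_x nu x * g x.
Proof.
move=> nu0 g0; rewrite mulr_sumr big_mkcond /=; apply: ler_sum => x _.
case: ifP => [ag|_]; last by rewrite mulr_ge0.
by rewrite mulrC ler_wpM2l.
Qed.

(** Equal total masses make the excess on [p] equal to the deficit off [p]; each is counted once in
    the l1 distance, which compensates the factor 1/2. *)
Lemma tv_dist_event (mu1 mu2 : C -> R) (p : pred C) :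
  \sum_x mu1 x = \sum_x mu2 x ->
  \sum_(x | p x) mu1 x - \sum_(x | p x) mu2 x <= tv_dist mu1 mu2.
Proof.
move=> E; rewrite -sumrB /tv_dist.
have h : \sum_x (mu1 x - mu2 x) = 0 by rewrite sumrB E subrr.
rewrite (bigID p) /= in h.
have h1 : \sum_(x | p x) (mu1 x - mu2 x) <= \sum_(x | p x) `|mu1 x - mu2 x|.
  by apply: ler_sum => x _; exact: ler_norm.
have h2 : - \sum_(x | ~~ p x) (mu1 x - mu2 x) <= \sum_(x | ~~ p x) `|mu1 x - mu2 x|.
  by rewrite -sumrN; apply: ler_sum => x _; rewrite ler_normr lexx orbT.
rewrite [X in 2^-1 * X](bigID p) /=; lra.
Qed.

Lemma inv_trans_le_Delta x y : 0 < P x y -> x != y -> (P x y)^-1 <= Delta C.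
Proof.
move=> p0 xy; apply: (le_bigmax_cond _ (fun p : C * C => (P p.1 p.2)^-1) (j := (x, y))).
by rewrite /= p0.
Qed.

(** * The directed distance *)

Lemma kernel_pow_dir_dist x y : 0 < kernel_pow P (dir_dist x y) x y.
Proof. by rewrite /dir_dist; case: ex_minnP. Qed.

Lemma dir_dist_le m x y : 0 < kernel_pow P m x y -> (dir_dist x y <= m)%N.
Proof. by move=> h; rewrite /dir_dist; case: ex_minnP => d _; exact. Qed.

Lemma kernel_powD_gt0 m n x y z :
  0 < kernel_pow P m x y -> 0 < kernel_pow P n y z -> 0 < kernel_pow P (m + n) x z.
Proof.
move=> h1 h2; rewrite kernel_powD (bigD1 y) //= ltr_wpDr ?mulr_gt0 //.
by apply: sumr_ge0 => w _; rewrite mulr_ge0 ?kernel_pow_ge0.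
Qed.

Lemma dir_dist_triangle x y z : (dir_dist x z <= dir_dist x y + dir_dist y z)%N.
Proof. by apply: dir_dist_le; exact: kernel_powD_gt0 (kernel_pow_dir_dist _ _)
  (kernel_pow_dir_dist _ _). Qed.

Lemma kernel_pow1 x y : kernel_pow P 1 x y = P x y.
Proof.
rewrite /= (bigD1 y) //= eqxx mulr1 big1 ?addr0 // => z /negbTE ->.
by rewrite mulr0.
Qed.

Lemma dir_dist_refl x : dir_dist x x = 0%N.
Proof. by apply/eqP; rewrite -leqn0 dir_dist_le //= eqxx. Qed.

Lemma dir_dist_eq0 x y : dir_dist x y = 0%N -> x = y.
Proof.
move=> E; have := kernel_pow_dir_dist x y; rewrite E /=.
by case: eqP => //; rewrite ltxx.
Qed.

Lemma dir_dist_edge_le1 x y : 0 < P x y -> (dir_dist x y <= 1)%N.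
Proof. by move=> h; apply: dir_dist_le; rewrite kernel_pow1. Qed.

Lemma dir_dist_edge_eq1 x y : 0 < P x y -> x != y -> dir_dist x y = 1%N.
Proof.
move=> h xy; apply/eqP; rewrite eqn_leq dir_dist_edge_le1 //= lt0n.
by apply: contraNN xy => /eqP /dir_dist_eq0 ->.
Qed.

Lemma dir_dist_step d x y : dir_dist x y = d.+1 ->
  exists z, [/\ 0 < P x z, x != z & dir_dist z y = d].
Proof.
move=> E; have := kernel_pow_dir_dist x y; rewrite E.
case/kernel_powS_gt0 => z Pz Kz.
have zd := dir_dist_le Kz; exists z; split => //.
  by apply/eqP => xz; move: zd; rewrite -xz E ltnn.
apply/eqP; rewrite eqn_leq zd -ltnS -E -add1n.
apply: leq_trans (dir_dist_triangle x z y) _.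
by rewrite leq_add2r dir_dist_edge_le1.
Qed.

Lemma back_dist_edge x y : 0 < P x y -> (dir_dist y x <= back_dist C)%N.
Proof.
have [->|xy h] := eqVneq x y; first by rewrite dir_dist_refl.
apply: (@leq_bigmax_cond _ (fun p : C * C => dir_dist p.1 p.2 == 1%N)
  (fun p => dir_dist p.2 p.1) (x, y)).
by rewrite /= dir_dist_edge_eq1.
Qed.

(** Each edge of a shortest path can be undone in at most [back_dist C] steps. *)
Lemma dir_dist_back x y : (dir_dist y x <= back_dist C * dir_dist x y)%N.
Proof.
move E : (dir_dist x y) => d; elim: d x E => [|d IH] x E.
  by rewrite (dir_dist_eq0 E) dir_dist_refl.
have [z [Pz xz Ez]] := dir_dist_step E.
apply: leq_trans (dir_dist_triangle y z x) _.
by rewrite mulnS addnC leq_add ?back_dist_edge // IH.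
Qed.

Lemma Delta_ge1 : 1 <= Delta C.
Proof.
have /card_gt1P[x [y [_ _ xy]]] := state_gt1 C.
case E : (dir_dist x y) => [|d]; first by move/dir_dist_eq0: E xy => ->; rewrite eqxx.
have [z [Pz xz _]] := dir_dist_step E.
apply: le_trans (inv_trans_le_Delta Pz xz).
by rewrite invf_ge1 // -kernel_pow1 kernel_pow_le1.
Qed.

Lemma Delta_gt0 : 0 < Delta C.
Proof. exact: lt_le_trans Delta_ge1. Qed.

Lemma ln_Delta_ge0 : 0 <= ln (Delta C).
Proof. exact: ln_ge0 Delta_ge1. Qed.

Lemma kernel_pow_dir_dist_ge x y :
  (Delta C) ^- dir_dist x y <= kernel_pow P (dir_dist x y) x y.
Proof.
move E : (dir_dist x y) => d; elim: d x E => [|d IH] x E.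
  by rewrite (dir_dist_eq0 E) /= eqxx expr0 invr1.
have [z [Pz xz Ez]] := dir_dist_step E.
rewrite /= (bigD1 z) //= -[leLHS]addr0 lerD //; last first.
  by apply: sumr_ge0 => w _; rewrite mulr_ge0 ?trans_ge0 ?kernel_pow_ge0.
rewrite exprS invfM; apply: ler_pM; rewrite ?invr_ge0 ?exprn_ge0 ?(ltW Delta_gt0)
  ?IH //.
by rewrite invf_ple ?posrE ?Delta_gt0 // inv_trans_le_Delta.
Qed.

(* A point at directed distance [d] from [x] is reached in [d] steps with
   probability at least [Delta^-d], so few points lie within a given distance. *)
Lemma ln_card_le (D : nat) : (forall x y, (dir_dist x y <= D)%N) ->
  ln (#|C|%:R : R) <= D%:R * ell.
Proof.
move=> HD; have /card_gt1P[x _] := state_gt1 C.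
have D0 := Delta_gt0.
(* The factor [D.+1] counts the times 0 to D, each of total mass 1. Its logarithm is at most D,
   which the summand 1 in [ell] absorbs. *)
have h : (#|C|%:R : R) <= D.+1%:R * Delta C ^+ D.
  rewrite -ler_pdivrMr ?exprn_gt0 //.
  have -> : #|C|%:R / Delta C ^+ D = \sum_(y : C) Delta C ^- D.
    by rewrite sumr_const mulr_natl.
  apply: (@le_trans _ _ (\sum_y \sum_(m < D.+1) kernel_pow P m x y)).
    apply: ler_sum => y _.
    have dy : (dir_dist x y < D.+1)%N by rewrite ltnS.
    rewrite (bigD1 (Ordinal dy)) //= -[leLHS]addr0 lerD //; last first.
      by apply: sumr_ge0 => m _; exact: kernel_pow_ge0.
    apply: le_trans (kernel_pow_dir_dist_ge x y).
    by rewrite lef_pV2 ?posrE ?exprn_gt0 // ler_weXn2l // Delta_ge1.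
  rewrite exchange_big /= (eq_bigr (fun=> 1)) => [|m _]; last exact: kernel_pow_sum1.
  by rewrite sumr_const card_ord.
have c0 : (0 : R) < #|C|%:R by rewrite ltr0n (ltn_trans _ (state_gt1 C)).
apply: le_trans (_ : ln (D.+1%:R * Delta C ^+ D) <= _).
  by rewrite ler_ln ?posrE // mulr_gt0 ?exprn_gt0 // ltr0n.
rewrite lnM ?posrE ?exprn_gt0 ?ltr0n // lnXn // -[ln _ *+ D]mulr_natl mulrDr mulr1.
rewrite lerD2r -[D.+1]add1n natrD le_ln1Dx //.
by rewrite (lt_le_trans (ltrN10 _)).
Qed.

(** * Lipschitz functions, concentration of the distance and the diameter *)

Lemma carre_lipschitz (f : C -> R) (b : R) x : 0 <= b ->
  (forall u v, 0 < P u v -> u != v -> `|f u - f v| <= b) -> Gam f f x <= 2^-1 * b ^+ 2.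
Proof.
move=> b0 Hb; rewrite ler_wpM2l ?invr_ge0 // -[leRHS]mulr1 -(trans_sum1 x) mulr_sumr.
apply: ler_sum => y _.
have [->|p0] := eqVneq (P x y) 0; first by rewrite !mulr0.
rewrite ler_wpM2r ?trans_ge0 // -expr2.
have [->|xy] := eqVneq x y; first by rewrite subrr expr0n /= sqr_ge0.
rewrite -real_normK ?num_real // lerXn2r ?nnegrE //.
by apply: Hb => //; rewrite lt_neqAle eq_sym p0 trans_ge0.
Qed.

(** A one-sided bound along edges becomes two-sided by following a return path, of length at most
    [back_dist C]. *)
Lemma lipschitz_back (f : C -> R) (b : R) : 0 <= b ->
  (forall u v, 0 < P u v -> u != v -> f u - f v <= b) ->
  forall u v, 0 < P u v -> `|f u - f v| <= k1 * b.
Proof.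
move=> b0 Hb u v Puv.
have h1 : f u - f v <= b.
  by have [->|uv] := eqVneq u v; [rewrite subrr|exact: Hb].
have h2 := path_lipschitz b0 Hb (kernel_pow_dir_dist v u).
have h3 : (dir_dist v u)%:R * b <= (back_dist C)%:R * b.
  by rewrite ler_wpM2r // ler_nat back_dist_edge.
have h4 : 0 <= (back_dist C)%:R * b by rewrite mulr_ge0.
rewrite mulrDl mul1r ler_norml; apply/andP; split; lra.
Qed.

Lemma dir_dist_lipschitz x u v : 0 < P u v ->
  `|(dir_dist x u)%:R - (dir_dist x v)%:R| <= k1.
Proof.
move=> Puv; rewrite -[leRHS]mulr1.
(* The sign is chosen because an edge from a to c gives d(x,c) - d(x,a) <= 1. *)
have := @lipschitz_back (fun z => - (dir_dist x z)%:R) 1.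
move=> /(_ ler01) h; rewrite -normrN opprD.
apply: (h _ u v Puv) => a c Pac _.
rewrite opprK addrC lerBlDr nat1r ler_nat.
apply: leq_trans (dir_dist_triangle x a c) _.
by rewrite -addn1 leq_add2l dir_dist_edge_le1.
Qed.

(** The Laplacian of the distance from [x] is at most 1, and this distance vanishes at [x]. *)
Lemma heat_dir_dist_le t x : 0 <= t ->
  heat t (fun y => (dir_dist x y)%:R) x <= t.
Proof.
move=> t0; pose f : C -> R := fun y => (dir_dist x y)%:R.
pose F s := heat s f x - s.
have D s : is_derive s (1 : R) F (_ - 1) := is_deriveB
  (heat_derive_path x (fun y => is_derive_cst (f y) s (1 : R))) (is_derive_id s (1
    : R)).
have : F t <= F 0.
  apply: (is_derive_nonincreasing D) => // s /andP[s0 _].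
  rewrite subr_le0 -[leRHS](heat_cst s 1 x); apply: heat_mono => [|y]; first exact: ltW.
  rewrite addr0 /laplacian -[leRHS](trans_sum1 y); apply: ler_sum => z _.
  rewrite -[leRHS]mulr1.
  have [->|p0] := eqVneq (P y z) 0; first by rewrite !mul0r.
  have Pyz : 0 < P y z by rewrite lt_neqAle eq_sym p0 trans_ge0.
  rewrite ler_wpM2l ?trans_ge0 // /f lerBlDr nat1r ler_nat -addn1.
  apply: leq_trans (dir_dist_triangle x y z) _.
  by rewrite leq_add2l dir_dist_edge_le1.
by rewrite /F heat0 /f dir_dist_refl !subr0 subr_le0.
Qed.

(** With r and s as in the proof, Markov's inequality puts heat mass above 1 - e/2 on distances
    below r, so [pi] gives them mass above e/2. Chebyshev's inequality leaves at most e/4 beyond s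
    from the mean; hence the mean is below r + s, and distances from r + 2 s on have mass at most
    e/4. *)
Lemma stat_dir_dist_tail t e x : 0 <= t -> 0 < e < 1 ->
  tv_dist (H t x) pi <= 1 - e ->
  \sum_(z | 2 * (t + 1) / e + 2 * (k1 * Num.sqrt (2 * trel C / e))
     <= (dir_dist x z)%:R) pi z < 2^-1.
Proof.
move=> t0 /andP[e0 e1] Htv.
pose f : C -> R := fun y => (dir_dist x y)%:R.
(* Using [t + 1] rather than [t] makes Markov's bound strict and keeps r positive at time 0. *)
set r := 2 * (t + 1) / e; set s := k1 * _.
have T0 := trel_gt0 C.
have k10 : 1 <= k1 by rewrite lerDl.
have r0 : 0 < r by rewrite divr_gt0 // mulr_gt0 // ltr_wpDl.
have s0 : 0 < s by rewrite mulr_gt0 ?sqrtr_gt0 ?divr_gt0 ?mulr_gt0 // (lt_le_trans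
  ltr01).
have f0 z : 0 <= f z by rewrite /f.
have heat_tail : \sum_(z | r <= f z) H t x z < 2^-1 * e.
  have h := le_trans (markov_sum r (heat_kernel_ge0 x ^~ t0) f0) (heat_dir_dist_le
    x t0).
  rewrite -(ltr_pM2l r0); apply: le_lt_trans h _.
  rewrite (_ : r * (2^-1 * e) = t + 1) ?ltrDl //.
  by rewrite /r; field; rewrite gt_eqF.
have low : 2^-1 * e < \sum_(z | f z < r) pi z.
  have h := @tv_dist_event (H t x) pi (fun z => f z < r).
  rewrite heat_kernel_sum1 stat_sum1 in h; have {}h := h (erefl _).
  have hE : \sum_(z | r <= f z) H t x z + \sum_(z | f z < r) H t x z = 1.
    rewrite -(heat_kernel_sum1 t x) [RHS](bigID (fun z => r <= f z)) /=; congr (_ + _).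
    by apply: eq_bigl => z; rewrite ltNge.
  lra.
pose m := stat_mean f.
have cheb : \sum_(z | s ^+ 2 <= (f z - m) ^+ 2) pi z <= 4^-1 * e.
  have h := markov_sum (s ^+ 2) (@stat_ge0 R C) (fun z => sqr_ge0 (f z - m)).
  rewrite -(ler_pM2l (exprn_gt0 2 s0)); apply: le_trans h _.
  rewrite (_ : \sum_x _ = stat_var f); last by apply: eq_bigr => z _; rewrite mulrC.
  apply: le_trans (poincare f) _.
  have -> : s ^+ 2 * (4^-1 * e) = trel C * (2^-1 * k1 ^+ 2).
    rewrite /s exprMn sqr_sqrtr; last by rewrite divr_ge0 ?mulr_ge0 // ltW.
    by field; rewrite gt_eqF.
  rewrite ler_wpM2l ?(ltW T0) // /dirichlet -[leRHS]mulr1.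
  rewrite -[X in _ <= _ * X](stat_sum1 C) mulr_sumr.
  apply: ler_sum => z _; rewrite ler_wpM2r ?stat_ge0 //.
  apply: carre_lipschitz => [|u v Puv _]; first exact: le_trans k10.
  exact: dir_dist_lipschitz.
have mrs : m < r + s.
  rewrite ltNge; apply/negP => rsm.
  have h : \sum_(z | f z < r) pi z <= \sum_(z | s ^+ 2 <= (f z - m) ^+ 2) pi z.
    apply: sum_pred_le => [z|z fz]; first exact: stat_ge0.
    have h : s <= - (f z - m) by lra.
    by rewrite -[leRHS]sqrrN lerXn2r // nnegrE; [exact: ltW|apply: le_trans h;
      exact: ltW].
  lra.
apply: (@le_lt_trans _ _ (\sum_(z | s ^+ 2 <= (f z - m) ^+ 2) pi z)); last lra.
apply: sum_pred_le => [z|z fz]; first exact: stat_ge0.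
rewrite -/(f z) in fz; have h : s <= f z - m by lra.
by rewrite lerXn2r // nnegrE; [exact: ltW|apply: le_trans h; exact: ltW].
Qed.

(** The two tails, each of mass below 1/2, miss a common point z; the path goes from x to z and then
    back along a path from y to z. *)
Lemma dir_dist_diameter t e x y : 0 <= t -> 0 < e < 1 ->
  (forall z, tv_dist (H t z) pi <= 1 - e) ->
  (dir_dist x y)%:R <=
    k1 * (2 * (t + 1) / e + 2 * (k1 * Num.sqrt (2 * trel C / e))).
Proof.
move=> t0 e01 Htv; have hx := stat_dir_dist_tail t0 e01 (Htv x).
have hy := stat_dir_dist_tail t0 e01 (Htv y).
set M := 2 * (t + 1) / e + _ in hx hy *.
have [z zx zy] : exists2 z, (dir_dist x z)%:R < M & (dir_dist y z)%:R < M.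
  suff /existsP[z /andP[]] : [exists z, ((dir_dist x z)%:R < M) && ((dir_dist y
    z)%:R < M)].
    by exists z.
  apply: contraT; rewrite negb_exists => /forallP h.
  suff : (1 : R) <= \sum_(z | M <= (dir_dist x z)%:R) pi z +
                 \sum_(z | M <= (dir_dist y z)%:R) pi z by lra.
  rewrite -[leLHS](stat_sum1 C) [leLHS](bigID (fun z => M <= (dir_dist x z)%:R)) /=
    lerD2l.
  apply: sum_pred_le => [w|w]; first exact: stat_ge0.
  by have := h w; rewrite negb_and -!leNgt => /orP[->|].
have h1 : (dir_dist x y)%:R <= (dir_dist x z)%:R + (back_dist C)%:R * (dir_dist y
  z)%:R :> R.
  rewrite -natrM -natrD ler_nat (leq_trans (dir_dist_triangle x z y)) //.
  by rewrite leq_add2l dir_dist_back.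
have h2 : (back_dist C)%:R * (dir_dist y z)%:R <= (back_dist C)%:R * M.
  by rewrite ler_wpM2l // ltW.
rewrite mulrDl mul1r; lra.
Qed.

End Geometry.

(** * Concentration of the log-density *)

Section Mixing.
Variables (R : realType) (C : markov_chain R).
Local Notation P := (@trans R C).
Local Notation pi := (@stat R C).
Local Notation H := (@heat_kernel R C).
Local Notation L := (@laplacian R C).
Local Notation Gam := (@carre_du_champ R C).
Local Notation ell := (1 + ln (Delta C)).
Local Notation k1 := (1 + (back_dist C)%:R : R).
Implicit Types (x y z u v o : C) (f : C -> R).

(** * The scale [window] and its comparison with mixing times *)

Lemma ell_ge1 : 1 <= ell.
Proof. by rewrite lerDl ln_Delta_ge0. Qed.

Lemma ln_card_le_real (M : R) : (forall x y, (dir_dist x y)%:R <= M) ->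
  ln (#|C|%:R : R) <= M * ell.
Proof.
move=> HM; have /card_gt1P[x [_ _]] := state_gt1 C.
have c0 : (0 < #|{: C * C}|)%N by apply/card_gt0P; exists (x, x).
have [p Ep] := @bigop.eq_bigmax _ (fun p : C * C => dir_dist p.1 p.2) c0.
apply: (@le_trans _ _ ((dir_dist p.1 p.2)%:R * ell)); last first.
  by rewrite ler_wpM2r // (le_trans ler01) // ell_ge1.
apply: ln_card_le => u v; rewrite -Ep.
exact: (@bigop.leq_bigmax _ (fun p : C * C => dir_dist p.1 p.2) (u, v)).
Qed.

(* The square of [t_rel (1+k)^2 (1 + log Delta)], to be compared with mixing times. *)
Definition window : R := trel C ^+ 2 * k1 ^+ 4 * ell ^+ 2.

Lemma k1_ge1 : 1 <= k1.
Proof. by rewrite lerDl. Qed.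

Lemma sqr_trel_back_window : (trel C * k1 ^+ 2 * ell) ^+ 2 = window.
Proof. by rewrite /window; ring. Qed.

Lemma trel_back_le_window : trel C * k1 <= 2 * window.
Proof.
have T1 := trel_ge_half C; have k11 := k1_ge1; have l1 := ell_ge1.
have k4 : k1 <= k1 ^+ 4 by rewrite -[leLHS]expr1 ler_weXn2l.
have l2 : 1 <= ell ^+ 2 by rewrite exprn_ege1.
have T2 : trel C <= 2 * trel C ^+ 2 by rewrite expr2; nra.
have k40 : 0 <= k1 ^+ 4 by rewrite exprn_ge0 // (le_trans ler01).
have h1 : trel C * k1 <= 2 * trel C ^+ 2 * k1 ^+ 4.
  by apply: ler_pM => //; lra.
apply: le_trans h1 _; rewrite /window.
have h0 : 0 <= 2 * trel C ^+ 2 * k1 ^+ 4 by rewrite mulr_ge0 // mulr_ge0 // sqr_ge0.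
have := ler_wpM2l h0 l2; lra.
Qed.

Lemma window_ge : 4^-1 <= window.
Proof.
have := trel_back_le_window; have T1 := trel_ge_half C; have k11 := k1_ge1.
have : trel C <= trel C * k1 by rewrite ler_peMr //; lra.
lra.
Qed.

Lemma sqrtr_le_self (a : R) : 1 <= a -> Num.sqrt a <= a.
Proof.
move=> a1; rewrite -[leRHS]ger0_norm ?(le_trans ler01) // -sqrtr_sqr.
by rewrite ler_sqrt ?sqr_ge0 // -[leLHS]expr1 ler_weXn2l.
Qed.

(** The left side of the hypothesis is [window] times [k1 * ell]. The diameter bound on the
    cardinality supplies the same factor, which cancels. *)
Lemma window_le_time (t e delta : R) : 0 <= t -> 0 < e < 1 -> 0 <= delta ->
  (forall z, tv_dist (H t z) pi <= 1 - e) ->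
  trel C ^+ 2 * k1 ^+ 5 * ell ^+ 3 <= delta * ln (#|C|%:R : R) ->
  32 * delta <= e -> window <= 4 * delta / e * t.
Proof.
move=> t0 /[dup] e01 /andP[e0 e1] d0 Htv Hd de.
have T1 := trel_ge_half C; have k11 := k1_ge1; have l1 := ell_ge1.
have kl0 : 0 < k1 * ell by rewrite mulr_gt0 //; lra.
have hN := ln_card_le_real (fun x y => dir_dist_diameter x y t0 e01 Htv).
set S := Num.sqrt _ in hN.
have hS : S <= 2 * trel C / e.
  by apply: sqrtr_le_self; rewrite ler_pdivlMr // mul1r; lra.
have hW : window <= delta * (2 * (t + 1) / e + 2 * (k1 * S)).
  rewrite -(ler_pM2l kl0).
  rewrite (_ : _ * window = trel C ^+ 2 * k1 ^+ 5 * ell ^+ 3);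
    last by rewrite /window; ring.
  apply: le_trans Hd _; rewrite mulrCA ler_wpM2l //.
  by apply: le_trans hN _; rewrite mulrAC.
have hk : k1 * S <= 4 * window / e.
  apply: (@le_trans _ _ (k1 * (2 * trel C / e))).
    by rewrite ler_wpM2l // (le_trans ler01).
  rewrite [leLHS]mulrA ler_wpM2r ?invr_ge0 ?(ltW e0) //.
  by have := trel_back_le_window; lra.
have W4 := window_ge.
have hW2 : window <= (delta / e) * (2 * t + 16 * window).
  apply: le_trans hW _; rewrite -[leRHS]mulrA ler_wpM2l //.
  have h5 : 2 * (t + 1) + 8 * window <= 2 * t + 16 * window by lra.
  have := ler_wpM2r (ltW (_ : 0 < e^-1)) h5; rewrite invr_gt0 => /(_ e0); lra.
(* The term 16 [window] on the right thus contributes at most half of [window] and is absorbed on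
   the left. *)
have de2 : delta / e <= 32^-1 by rewrite ler_pdivrMr //; lra.
have W0 : 0 <= window by lra.
have := ler_wpM2r W0 de2; rewrite -[4 * _ / e]mulrA; lra.
Qed.

(** * Total variation from variance decay *)

Lemma heat_kernelD s t x y : H (s + t) x y = \sum_z H s x z * H t z y.
Proof.
have E r w : H r w y = heat r (fun z => (z == y)%:R) w.
  rewrite /heat (bigD1 y) //= eqxx mulr1 big1 ?addr0 // => z /negbTE ->.
  by rewrite mulr0.
by rewrite E heat_add; apply: eq_bigr => z _; rewrite -E.
Qed.

(* Duality with the sign function reduces this to the decay of the variance; the
   free parameter [c] replaces Cauchy-Schwarz by AM-GM. *)
Lemma heat_centered_l1_le (nu : C -> R) s (c : R) : 0 <= s -> 0 < c ->
  \sum_y `|\sum_x nu x * H s x y - (\sum_x nu x) * pi y| <=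
  2^-1 * (c * (\sum_x nu x ^+ 2 / pi x) + expR (- (2 * s / trel C)) / c).
Proof.
move=> s0 c0; set w := fun y => \sum_x nu x * H s x y - (\sum_x nu x) * pi y.
pose f y := Num.sg (w y).
have -> : \sum_y `|w y| = \sum_x nu x * (heat s f x - stat_mean f).
  rewrite (eq_bigr (fun y => (\sum_x nu x * (H s x y * f y)) - (\sum_x nu x) * (f y
    * pi y))).
    rewrite sumrB exchange_big /= -mulr_sumr mulr_suml -sumrB.
    by apply: eq_bigr => x _; rewrite -mulr_sumr -mulrBr.
  move=> y _; rewrite normrEsg -/(f y) /w mulrBr mulr_sumr; congr (_ - _); last by ring.
  by apply: eq_bigr => x _; ring.
apply: (@le_trans _ _ (\sum_x 2^-1 * (c * (nu x ^+ 2 / pi x) +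
    (heat s f x - stat_mean f) ^+ 2 * pi x / c))).
  apply: ler_sum => x _; set g := heat s f x - _.
  have px := stat_gt0 x.
  have := sqr_ge0 (c * nu x - g * pi x).
  rewrite -(pmulr_rge0 _ (_ : 0 < (c * pi x)^-1)) ?invr_gt0 ?mulr_gt0 //.
  rewrite (_ : (c * pi x)^-1 * _ = c * (nu x ^+ 2 / pi x) + g ^+ 2 * pi x / c - 2 *
    (nu x * g)).
    lra.
  by field; rewrite !gt_eqF.
rewrite -mulr_sumr big_split /= -mulr_sumr -mulr_suml ler_wpM2l ?invr_ge0 //.
rewrite lerD2l ler_wpM2r ?invr_ge0 ?(ltW c0) //.
rewrite -(stat_meanB_var (stat_mean_heat s f));
  apply: le_trans (stat_var_heat_le f s0) _.
rewrite -[leRHS]mulr1 ler_wpM2l ?expR_ge0 //.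
have hv : stat_var f = \sum_x f x ^+ 2 * pi x - stat_mean f ^+ 2.
  rewrite /stat_var (eq_bigr (fun x => f x ^+ 2 * pi x - 2 * stat_mean f * (f x * pi x)
     + stat_mean f ^+ 2 * pi x)); last by move=> x _; ring.
  rewrite big_split sumrB /= -!mulr_sumr stat_sum1 -/(stat_mean f); ring.
rewrite hv lerBlDr -[leLHS]addr0 lerD ?sqr_ge0 // -[leRHS](stat_sum1 C).
apply: ler_sum => x _; rewrite -[leRHS]mul1r ler_wpM2r ?stat_ge0 //.
by rewrite /f sqr_sg; case: (_ != _).
Qed.

(** The law at time t is split along [A]. The part off [A] costs at most its mass; the part on [A]
    has a density in L^2 and is mixed during the time s. *)
Lemma tv_dist_heat_le (t s c : R) o (A : pred C) : 0 <= t -> 0 <= s -> 0 < c ->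
  tv_dist (H (t + s) o) pi <= \sum_(x | ~~ A x) H t o x +
   4^-1 * (c * (\sum_(x | A x) H t o x ^+ 2 / pi x) + expR (- (2 * s / trel C)) / c).
Proof.
move=> t0 s0 c0.
pose nu x := if A x then H t o x else 0.
pose nu' x := if A x then 0 else H t o x.
have nu0' x : 0 <= nu' x by rewrite /nu'; case: ifP => // _; exact: heat_kernel_ge0.
have hnu := @heat_centered_l1_le nu s c s0 c0.
have EQ : \sum_x nu x ^+ 2 / pi x = \sum_(x | A x) H t o x ^+ 2 / pi x.
  rewrite [RHS]big_mkcond /=; apply: eq_bigr => x _; rewrite /nu; case: ifP => // _.
  by rewrite expr0n /= mul0r.
have EN : \sum_x nu' x = \sum_(x | ~~ A x) H t o x.
  by rewrite [RHS]big_mkcond /=; apply: eq_bigr => x _; rewrite /nu'; case: ifP.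
have hnu' : \sum_y `|\sum_x nu' x * H s x y - (\sum_x nu' x) * pi y| <= 2 * \sum_x
  nu' x.
  apply: (@le_trans _ _ (\sum_y (\sum_x nu' x * H s x y + (\sum_x nu' x) * pi y))).
    apply: ler_sum => y _; apply: le_trans (ler_normB _ _) _.
    rewrite lerD // ger0_norm //.
      by apply: sumr_ge0 => x _; rewrite mulr_ge0 ?heat_kernel_ge0.
    by rewrite mulr_ge0 ?stat_ge0 ?sumr_ge0.
  rewrite big_split /= -mulr_sumr stat_sum1 exchange_big /=.
  rewrite (eq_bigr nu') => [|x _]; first by lra.
  by rewrite -mulr_sumr heat_kernel_sum1 mulr1.
rewrite -EQ -EN /tv_dist.
have key : \sum_y `|H (t + s) o y - pi y| <=
   \sum_y `|\sum_x nu x * H s x y - (\sum_x nu x) * pi y| +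
   \sum_y `|\sum_x nu' x * H s x y - (\sum_x nu' x) * pi y|.
  rewrite -big_split /=; apply: ler_sum => y _.
  apply: le_trans (ler_normD _ _); rewrite le_eqVlt; apply/orP; left; apply/eqP.
  congr (`|_|).
  have E : pi y = (\sum_x nu x) * pi y + (\sum_x nu' x) * pi y.
    rewrite -mulrDl -big_split /= (eq_bigr (H t o)).
      by rewrite heat_kernel_sum1 mul1r.
    by move=> x _; rewrite /nu /nu'; case: ifP; rewrite ?addr0 ?add0r.
  rewrite [in LHS]E heat_kernelD [RHS]addrACA -opprD -big_split /=; congr (_ - _).
  apply: eq_bigr => x _; rewrite -mulrDl; congr (_ * _).
  by rewrite /nu /nu'; case: ifP; rewrite ?addr0 ?add0r.
lra.
Qed.

(** Ensures that the set whose infimum is [tmix] is nonempty. The L^2 bound is used from time 0,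
    where the density has second moment [(pi o)^-1]; [c] makes the first term at most [e], and then
    [s] the second. *)
Lemma exists_mixing (e : R) : 0 < e ->
  exists2 t, 0 <= t & forall o, tv_dist (H t o) pi <= e.
Proof.
move=> e0; pose Q := \sum_o (pi o)^-1.
have piV0 o : 0 <= (pi o)^-1 by rewrite invr_ge0 stat_ge0.
have Q0 : 0 <= Q by exact: sumr_ge0.
pose c := e / (Q + 1).
have c0 : 0 < c by rewrite divr_gt0 // ltr_wpDl.
have T0 := trel_gt0 C.
pose s := trel C * `|ln (e * c)|.
have s0 : 0 <= s by rewrite mulr_ge0 ?(ltW T0).
exists s => [//|o]; rewrite -[s]add0r.
apply: le_trans (@tv_dist_heat_le 0 s c o xpredT (lexx _) s0 c0) _.
rewrite big_pred0 ?add0r //.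
have h1 : c * (\sum_x H 0 o x ^+ 2 / pi x) <= e.
  rewrite (bigD1 o) //= big1 ?addr0; last first.
    by move=> x /negbTE xo; rewrite heat_kernel0 eq_sym xo expr0n /= mul0r.
  rewrite heat_kernel0 eqxx expr1n mul1r /c mulrAC ler_pdivrMr ?ltr_wpDl //.
  rewrite ler_wpM2l ?(ltW e0) // /Q (bigD1 o) //= -addrA lerDl addr_ge0 //.
  exact: sumr_ge0.
have h2 : expR (- (2 * s / trel C)) / c <= e.
  rewrite ler_pdivrMr // -[leRHS]lnK ?posrE ?(mulr_gt0 e0 c0) // ler_expR.
  rewrite /s (_ : 2 * _ / _ = 2 * `|ln (e * c)|); last by field; rewrite gt_eqF.
  have := ler_norm (- ln (e * c)); rewrite normrN.
  have := normr_ge0 (ln (e * c)); lra.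
lra.
Qed.

(** * From a variance bound on the log-density to mixing *)

Section LogDensity.
Variables (t e V : R) (o : C).
Hypotheses (t0 : 0 < t) (e01 : 0 < e < 1) (V0 : 0 < V).

Definition log_density x := ln (H t o x) - ln (pi x).

Hypothesis HV : heat t (fun x => log_density x ^+ 2) o - heat t log_density o ^+ 2 <= V.
Hypothesis Htv : tv_dist (H t o) pi <= 1 - e.

(** The log-density f stays within th of its mean m outside heat mass e/2, and the overlap with [pi]
    gives m <= th + ln (2/e). Truncated at m + th, the density has second moment at most exp(m +
    th), which the extra time contracts. *)
Lemma tv_dist_after_window :
  tv_dist (H (t + trel C * (Num.sqrt (2 * V / e) + 2 * ln (2 / e))) o) pi <= e.
Proof.
have /andP[e0 e1] := e01.
set th := Num.sqrt _; set f := log_density; set m := heat t f o.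
(* With [th ^+ 2 = 2 * V / e], Chebyshev's bound [V / th ^+ 2] equals e/2. *)
have th0 : 0 < th by rewrite sqrtr_gt0 divr_gt0 // mulr_gt0.
have th2 : th ^+ 2 = 2 * V / e by rewrite sqr_sqrtr // divr_ge0 ?mulr_ge0 // ltW.
have mu0 x : 0 <= H t o x by rewrite heat_kernel_ge0 // ltW.
have mu1 x : 0 < H t o x by rewrite heat_kernel_gt0.
have T0 := trel_gt0 C.
have fE x : H t o x = pi x * expR (f x).
  by rewrite /f /log_density expRB !lnK ?posrE ?stat_gt0 // mulrCA divff ?mulr1 //
    gt_eqF // stat_gt0.
have cheb : \sum_(x | th ^+ 2 <= (f x - m) ^+ 2) H t o x <= 2^-1 * e.
  have h := markov_sum (th ^+ 2) mu0 (fun x => sqr_ge0 (f x - m)).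
  rewrite -(ler_pM2l (exprn_gt0 2 th0)); apply: le_trans h _.
  rewrite (_ : \sum_x _ = heat t (fun x => f x ^+ 2) o - m ^+ 2).
    by apply: le_trans HV _; rewrite th2 le_eqVlt; apply/orP; left; apply/eqP; field;
      rewrite gt_eqF.
  rewrite (eq_bigr (fun x => H t o x * f x ^+ 2 - 2 * m * (H t o x * f x)
     + m ^+ 2 * H t o x)); last by move=> x _; ring.
  rewrite big_split sumrB /= -mulr_sumr -[X in _ + X]mulr_sumr heat_kernel_sum1.
  by rewrite -/(heat t (fun x => f x ^+ 2) o) -/(heat t f o) -/m; ring.
have low : \sum_(x | ~~ (m - th < f x)) H t o x <= 2^-1 * e.
  apply: le_trans cheb; apply: sum_pred_le => // x; rewrite -leNgt => h.
  have h1 : th <= - (f x - m) by lra.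
  by rewrite -[leRHS]sqrrN lerXn2r // nnegrE; [exact: ltW|apply: le_trans h1;
    exact: ltW].
have high : \sum_(x | ~~ (f x < m + th)) H t o x <= 2^-1 * e.
  apply: le_trans cheb; apply: sum_pred_le => // x; rewrite -leNgt => h.
  have h1 : th <= f x - m by lra.
  by rewrite lerXn2r // nnegrE; [exact: ltW|apply: le_trans h1; exact: ltW].
(* The event f > m - th has heat mass at least 1 - e/2, hence [pi]-mass at least e/2; but the
   density there exceeds exp(m - th), so its [pi]-mass is at most exp(th - m). *)
have m_le : m <= th + ln (2 / e).
  have h1 := @tv_dist_event R C (H t o) pi (fun x => m - th < f x).
  rewrite heat_kernel_sum1 stat_sum1 /= in h1; have {}h1 := h1 (erefl _).
  have h2 : \sum_(x | m - th < f x) H t o x + \sum_(x | ~~ (m - th < f x)) H t o x = 1.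
    by rewrite -(heat_kernel_sum1 t o) [RHS](bigID (fun x => m - th < f x)).
  have h3 : \sum_(x | m - th < f x) pi x <= expR (th - m).
    rewrite -[leRHS]mulr1 -[X in _ <= _ * X](heat_kernel_sum1 t o) mulr_sumr
      big_mkcond /=.
    apply: ler_sum => x _; case: ifP => [h|_]; last by rewrite mulr_ge0 ?expR_ge0.
    rewrite fE mulrCA -[leLHS]mulr1 ler_wpM2l ?stat_ge0 // -expRD.
    by rewrite -expR0 ler_expR; lra.
  have h5 := le_trans h1 Htv.
  have h4 : 2^-1 * e <= expR (th - m).
    move: h5 h2 h3 low; move: (\sum_(x | ~~ _) H t o x) => a2.
    move: (\sum_(x | _) H t o x) => a1; move: (\sum_(x | _) pi x) => a3.
    move: (expR _) => a4. lra.
  rewrite -ler_ln ?posrE ?expR_gt0 ?mulr_gt0 ?invr_gt0 // expRK in h4.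
  have -> : ln (2 / e) = - ln (2^-1 * e).
    by rewrite -lnV ?posrE ?mulr_gt0 ?invr_gt0 // invfM invrK.
  lra.
set s := trel C * _.
have ln2e : 0 <= ln (2 / e) by apply: ln_ge0; rewrite ler_pdivlMr // mul1r; lra.
have s0 : 0 <= s by rewrite mulr_ge0 ?(ltW T0) // addr_ge0 ?mulr_ge0 // ltW.
(* This [c] makes the second-moment term at most [e]; with [hE] the total is e/2 + (e + e)/4 = e. *)
pose c := e * expR (- (m + th)).
have c0 : 0 < c by rewrite mulr_gt0 ?expR_gt0.
apply: le_trans (@tv_dist_heat_le t s c o (fun x => f x < m + th) (ltW t0) s0 c0) _.
have hQ : c * (\sum_(x | f x < m + th) H t o x ^+ 2 / pi x) <= e.
  have h : \sum_(x | f x < m + th) H t o x ^+ 2 / pi x <= expR (m + th).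
    rewrite -[leRHS]mulr1 -[X in _ <= _ * X](heat_kernel_sum1 t o) mulr_sumr
      big_mkcond /=.
    apply: ler_sum => x _; case: ifP => [h|_]; last by rewrite mulr_ge0 ?expR_ge0.
    rewrite expr2 -mulrA mulrC ler_wpM2r // fE mulrAC divff ?gt_eqF ?stat_gt0 // mul1r.
    by rewrite ler_expR ltW.
  apply: le_trans (ler_wpM2l (ltW c0) h) _.
  by rewrite /c -mulrA -expRD addNr expR0 mulr1.
have hE : expR (- (2 * s / trel C)) / c <= e.
  rewrite ler_pdivrMr // /c [leRHS]mulrA -[e * e]lnK ?posrE ?mulr_gt0 // -expRD
    ler_expR.
  rewrite lnM ?posrE //.
  have -> : 2 * s / trel C = 2 * (th + 2 * ln (2 / e)) by rewrite /s; field;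
    rewrite gt_eqF.
  have l2 : ln (2 / e) = ln 2 - ln e by rewrite ln_div ?posrE.
  have : (0 : R) <= ln 2 by apply: ln_ge0; lra.
  lra.
lra.
Qed.

End LogDensity.

End Mixing.

(** * Gradient of the log-density *)

Section LogGradient.
Variables (R : realType) (C : markov_chain R).
Local Notation P := (@trans R C).
Local Notation pi := (@stat R C).
Local Notation H := (@heat_kernel R C).
Local Notation L := (@laplacian R C).
Local Notation Gam := (@carre_du_champ R C).
Local Notation ell := (1 + ln (Delta C)).
Local Notation k1 := (1 + (back_dist C)%:R : R).
Implicit Types (x y z u v o : C) (f : C -> R).

(** * Elementary bounds and lower bounds on the heat kernel *)

Lemma fact_le_exp d : (d`! <= d ^ d)%N.
Proof.
elim: d => // d IH; rewrite factS expnS leq_mul2l /= (leq_trans IH) //.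
by case: d {IH} => // d; rewrite leq_exp2r.
Qed.

Lemma expR1_ge2 : 2 <= expR 1 :> R.
Proof. by have := expR_ge1Dx (1 : R); lra. Qed.

Lemma expR1_le4 : expR 1 <= 4 :> R.
Proof.
have h := expR_ge1Dx (- 2^-1 : R).
have e0 := expR_gt0 (- 2^-1 : R).
have -> : expR 1 = (expR (- 2^-1) ^+ 2)^-1 :> R.
  rewrite -exprVn -expRN opprK expr2 -expRD; congr expR; lra.
rewrite -[leRHS]invrK lef_pV2 ?posrE ?invr_gt0 ?exprn_gt0 //; nra.
Qed.

Lemma ln_le_sub1 (x : R) : 0 < x -> ln x <= x - 1.
Proof.
move=> x0; have := @le_ln1Dx R (x - 1); rewrite subrKC; apply; lra.
Qed.

(** Since d! <= d^d, it suffices that d/t <= exp(d/t), raised to the power d. *)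
Lemma exp_le_pow_fact (t : R) d : 0 < t -> expR (- (d%:R ^+ 2 / t)) <= t ^+ d / d`!%:R.
Proof.
move=> t0; rewrite expRN -[leRHS]invrK lef_pV2 ?posrE ?expR_gt0 //; last first.
  by rewrite invr_gt0 divr_gt0 ?exprn_gt0 // ltr0n fact_gt0.
rewrite invf_div ler_pdivrMr ?exprn_gt0 //.
rewrite expr2 -mulrA expRM_natl -exprMn.
apply: (@le_trans _ _ (d%:R ^+ d)); first by rewrite -natrX ler_nat fact_le_exp.
apply: lerXn2r; rewrite ?nnegrE ?ler0n ?mulr_ge0 ?expR_ge0 ?(ltW t0) //.
rewrite -ler_pdivrMr //; apply: le_trans (expR_ge1Dx _); lra.
Qed.

(** Only the term at m = d(o,x) is kept: its Poisson factor is at least exp(-K^2 t), and a shortest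
    path has probability at least Delta^(-K t). *)
Lemma egf_kernel_ge (t K : R) o x : 0 < t -> 0 <= K ->
  (dir_dist o x)%:R <= K * t ->
  expR (- (K ^+ 2 * t + K * t * ln (Delta C))) <=
    egf (fun m => kernel_pow P m o x) t.
Proof.
move=> t0 K0 HK; set d := dir_dist o x in HK.
have h := @egf_ge_term R (fun m => kernel_pow P m o x) t d (kernel_pow_geo o x)
  (ltW t0) (fun m => kernel_pow_ge0 m o x).
apply: le_trans h; rewrite opprD expRD.
apply: ler_pM; rewrite ?expR_ge0 //.
  apply: le_trans (exp_le_pow_fact d t0).
  rewrite ler_expR lerN2 ler_pdivrMr // -mulrA -expr2 -exprMn.
  by rewrite lerXn2r // nnegrE // mulr_ge0 // ltW.
apply: le_trans (kernel_pow_dir_dist_ge o x).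
rewrite -/d -[in leRHS](lnK (_ : Delta C \is Num.pos)) ?posrE ?Delta_gt0 //.
rewrite -expRM_natl -expRN ler_expR lerN2.
by rewrite ler_wpM2r // ln_Delta_ge0.
Qed.

(** Appending the jump from x to y to an m-step path costs P(x,y) and changes the Poisson weight by
    t/(m+1). This is at least t/A unless m + 1 exceeds A, and so many jumps are negligible against
    the lower bound for the kernel. *)
Lemma ln_heat_kernel_step (t K : R) o x y : 1 <= t -> 1 <= K ->
  (dir_dist o x)%:R <= K * t -> 0 < P x y -> x != y ->
  ln (H t o x) - ln (H t o y) <= 13 * (K * ell).
Proof.
move=> t1 K1 HK Pxy xy.
have t0 : 0 < t by lra.
have K0 : 0 < K by lra.
have l1 : 1 <= ell := ell_ge1 C.
have hx := egf_kernel_ge t0 (ltW K0) HK.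
set ex := egf _ t in hx; set u := K ^+ 2 * t + _ in hx.
pose ey := egf (fun m => kernel_pow P m o y) t.
have ex0 : 0 < ex := lt_le_trans (expR_gt0 _) hx.
have Kl : 1 <= K * ell by rewrite mulr_ege1.
have lKl : ell <= K * ell by rewrite ler_peMl //; lra.
have KKl : K <= K * ell by rewrite ler_peMr //; lra.
(* A exceeds u + 4 t + 2: here exp(-u) bounds [ex] from below, 4 t covers the exponential moment
   with base e, and the remaining 2 leaves a factor exp(-1) <= 1/2 in [tail]. *)
pose A := 7 * t * K ^+ 2 * ell.
have K2 : K <= K ^+ 2 by rewrite -[leLHS]expr1 ler_weXn2l.
have K2l : 1 <= K ^+ 2 * ell by rewrite mulr_ege1 // (le_trans K1).
have uA : u + 4 * t + 2 <= A.
  have h1 : K * ln (Delta C) <= K ^+ 2 * ln (Delta C) by rewrite ler_wpM2r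
    ?ln_Delta_ge0.
  have h2 := ler_wpM2l (ltW t0) h1.
  have h3 := ler_wpM2l (ltW t0) K2l.
  rewrite /A /u; lra.
have A0 : 0 < A.
  by rewrite /A !mulr_gt0 // ?exprn_gt0 //; lra.
have step : P x y * (t / A) * (ex - expR (t * expR 1) / expR (A - 1)) <= ey.
  apply: egf_shift_ge => //.
  - exact: kernel_pow_geo.
  - exact: kernel_pow_geo.
  - exact: expR_gt0.
  - by move=> m; rewrite kernel_pow_ge0 kernel_pow_le1.
  - by move=> m; exact: kernel_pow_ge0.
  - move=> m; rewrite kernel_powSr (bigD1 x) //= mulrC lerDl.
    by apply: sumr_ge0 => z _; rewrite mulr_ge0 ?kernel_pow_ge0 ?trans_ge0.
  - move=> m Am; rewrite -expRM_natl mulr1 ler_expR lerBlDr natr1 //.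
have tail : expR (t * expR 1) / expR (A - 1) <= 2^-1 * ex.
  rewrite -expRN -expRD; apply: (@le_trans _ _ (expR (- 1) * expR (- u))).
    rewrite -expRD ler_expR; have := ler_wpM2l (ltW t0) expR1_le4; lra.
  apply: ler_pM; rewrite ?expR_ge0 //.
  by rewrite expRN lef_pV2 ?posrE ?expR_gt0 // expR1_ge2.
have pt0 : 0 < P x y * (t / A) by rewrite mulr_gt0 // divr_gt0.
have {}step : P x y / (14 * K ^+ 2 * ell) * ex <= ey.
  apply: le_trans step; rewrite (_ : P x y / _ * ex = P x y * (t / A) * (2^-1 * ex)).
    by rewrite ler_wpM2l ?(ltW pt0) //; lra.
  by rewrite /A; field; rewrite !gt_eqF //; lra.
have q0 : 0 < 14 * K ^+ 2 * ell by rewrite !mulr_gt0 // ?exprn_gt0 //; lra.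
have ey0 : 0 < ey by apply: lt_le_trans step; rewrite mulr_gt0 // divr_gt0.
have pq0 : 0 < P x y / (14 * K ^+ 2 * ell) by rewrite divr_gt0.
have hln : ln (P x y / (14 * K ^+ 2 * ell) * ex) <= ln ey.
  by rewrite ler_ln // posrE mulr_gt0.
rewrite lnM ?posrE // ln_div ?posrE // in hln.
have q_ln : ln (14 * K ^+ 2 * ell) = ln 14 + 2 * ln K + ln ell.
  have l0 : 0 < ell by lra.
  have K20 : 0 < K ^+ 2 by rewrite exprn_gt0.
  rewrite lnM ?posrE // ?mulr_gt0 // lnM ?posrE // lnXn //.
  by rewrite -[ln K *+ 2]mulr_natl.
(* With ln z <= z - 1 the total is at most 13 + 2(K - 1) + 2(ell - 1) = 9 + 2 K + 2 ell, hence at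
   most 13 K ell. *)
have := ln_le_sub1 K0; have := @ln_le_sub1 14 (ltr0n _ 14).
have := @ln_le_sub1 ell (lt_le_trans ltr01 l1).
have hp : - ln (P x y) <= ln (Delta C).
  by rewrite -lnV ?posrE // ler_ln ?posrE ?invr_gt0 ?Delta_gt0 // inv_trans_le_Delta.
rewrite !heat_kernelE -/ex -/ey !lnM ?posrE ?expR_gt0 //; lra.
Qed.

(** Stationarity gives pi(y) >= pi(x) P(x,y). *)
Lemma ln_stat_step x y : 0 < P x y -> x != y -> ln (pi x) - ln (pi y) <= ln (Delta C).
Proof.
move=> Pxy xy.
have h : pi x * P x y <= pi y.
  rewrite -[leRHS]stat_stationary (bigD1 x) //= lerDl.
  by apply: sumr_ge0 => z _; rewrite mulr_ge0 ?stat_ge0 ?trans_ge0.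
have hln : ln (pi x * P x y) <= ln (pi y).
  by rewrite ler_ln // posrE ?mulr_gt0 ?stat_gt0.
rewrite lnM ?posrE ?stat_gt0 // in hln.
have hp : - ln (P x y) <= ln (Delta C).
  by rewrite -lnV ?posrE // ler_ln ?posrE ?invr_gt0 ?Delta_gt0 // inv_trans_le_Delta.
lra.
Qed.

(** The one-step bounds, 13 for the kernel and 1 for [pi], become two-sided through
    [lipschitz_back]. *)
Lemma log_density_lipschitz (t K : R) o u v : 1 <= t -> 1 <= K ->
  (forall x, (dir_dist o x)%:R <= K * t) -> 0 < P u v ->
  `|log_density t o u - log_density t o v| <= 14 * (k1 * (K * ell)).
Proof.
move=> t1 K1 HK Puv.
have l1 : 1 <= ell := ell_ge1 C; have k11 : 1 <= k1 := k1_ge1 C.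
have Kl : 1 <= K * ell by rewrite mulr_ege1.
have lKl : ell <= K * ell by rewrite ler_peMl //; lra.
have h1 : `|ln (H t o u) - ln (H t o v)| <= k1 * (13 * (K * ell)).
  apply: (lipschitz_back (f := fun x => ln (H t o x))) => // [|a b Pab ab];
    first by lra.
  exact: ln_heat_kernel_step.
have h2 : `|ln (pi u) - ln (pi v)| <= k1 * (K * ell).
  apply: (lipschitz_back (f := fun x => ln (pi x))) => // [|a b Pab ab]; first by lra.
  by apply: le_trans (ln_stat_step Pab ab) _; lra.
rewrite /log_density.
rewrite (_ : _ - _ = (ln (H t o u) - ln (H t o v)) - (ln (pi u) - ln (pi v)));
  last by ring.
apply: le_trans (ler_normB _ _) _; lra.
Qed.

Lemma log_density_var_le (t K : R) o : (0 <= bakry_emery C)%E ->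
  1 <= t -> 1 <= K -> (forall x, (dir_dist o x)%:R <= K * t) ->
  heat t (fun x => log_density t o x ^+ 2) o - heat t (log_density t o) o ^+ 2 <=
    t * (14 * (k1 * (K * ell))) ^+ 2.
Proof.
move=> be t1 K1 HK; have t0 : 0 <= t by lra.
have l1 : 1 <= ell := ell_ge1 C; have k11 : 1 <= k1 := k1_ge1 C.
set b := 14 * _.
have b0 : 0 <= b by rewrite !mulr_ge0 //; lra.
apply: le_trans (local_poincare be (log_density t o) o t0) _.
have h : heat t (Gam (log_density t o) (log_density t o)) o <= 2^-1 * b ^+ 2.
  rewrite -[leRHS](heat_cst t _ o); apply: heat_mono => // y.
  by apply: carre_lipschitz => // u v Puv _; exact: log_density_lipschitz.
have := ler_wpM2l (mulr_ge0 (ler0n _ 2) t0) h; lra.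
Qed.

(** * Mixing times as infima *)

Definition mixing_times (e : R) : set R :=
  [set t | 0 <= t /\ forall o, tv_dist (H t o) pi <= e].

(** Nonnegativity of [e] accounts for the default value 0 of the maximum. *)
Lemma tmixE (e : R) : 0 <= e -> tmix C e = inf (mixing_times e).
Proof.
move=> e0; congr inf; apply/seteqP; split => t /= [t0 h]; split => //.
  by move=> o; apply: le_trans h; exact: (le_bigmax _ (fun x => tv_dist (H t x) pi)).
by apply: bigmax_le => // o _; exact: h.
Qed.

Lemma mixing_times_inf (e : R) : 0 < e -> has_inf (mixing_times e).
Proof.
move=> e0; split; last by exists 0 => t [].
by have [t t0 ht] := exists_mixing C e0; exists t.
Qed.

Lemma tmix_le (e t : R) : 0 <= e -> mixing_times e t -> tmix C e <= t.
Proof.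
by move=> e0 ht; rewrite tmixE //; apply: ge_inf => //; exists 0 => s [].
Qed.

Lemma le_tmix (e a : R) : 0 < e -> (forall t, mixing_times e t -> a <= t) ->
  a <= tmix C e.
Proof.
move=> e0 h; rewrite tmixE ?(ltW e0) //; apply: lb_le_inf => //.
by have [] := mixing_times_inf e0.
Qed.

Lemma tmix_lt (e a : R) : 0 < e -> tmix C e < a ->
  exists2 t, mixing_times e t & t < a.
Proof.
by move=> e0; rewrite tmixE ?(ltW e0) // => /(inf_lt (proj1 (mixing_times_inf e0))).
Qed.

(* [84 = 14 * 6]: the constant of [log_density_lipschitz] times that of the
   diameter bound [K = 6 / e * (1 + k)] used in [tmix_window]. *)
Definition window_cst (e : R) : R := 84 / e * Num.sqrt (2 / e) + 2 * ln (2 / e).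

(** The log-density has variance at most t b^2, with [trel C] times b a multiple of sqrt [window].
    The extra mixing time is thus of order sqrt ([window] t) + [trel C], and both terms are O(sqrt
    eta t). *)
Lemma tmix_window (e eta t : R) : (0 <= bakry_emery C)%E ->
  0 < e < 1 -> 0 < eta -> eta <= 4^-1 -> mixing_times (1 - e) t ->
  window C <= eta * t ->
  tmix C e <= (1 + window_cst e * Num.sqrt eta) * t.
Proof.
move=> be /[dup] e01 /andP[e0 e1] eta0 eta4 [t0 Htv] Ht.
have T1 := trel_ge_half C; have k11 : 1 <= k1 := k1_ge1 C.
have l1 : 1 <= ell := ell_ge1 C; have W4 := window_ge C.
(* From 1/4 <= [window] <= eta t <= t/4. *)
have t1 : 1 <= t by have := ler_wpM2r t0 eta4; lra.
have {}t0 : 0 < t by lra.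
pose K := 6 / e * k1.
have K1 : 1 <= K by rewrite mulr_ege1 // ler_pdivlMr // mul1r; lra.
have HK o x : (dir_dist o x)%:R <= K * t.
  apply: le_trans (dir_dist_diameter o x (ltW t0) e01 Htv) _.
  rewrite (_ : K * t = k1 * (6 / e * t)); last by rewrite /K; ring.
  apply: ler_wpM2l; first exact: le_trans k11.
  set S := Num.sqrt _.
  have hS : S <= 2 * trel C / e.
    by apply: sqrtr_le_self; rewrite ler_pdivlMr // mul1r; lra.
  have h2 := ler_wpM2l (le_trans ler01 k11) hS.
  have h3 : trel C * k1 <= 2^-1 * t.
    have := trel_back_le_window C; have := ler_wpM2r (ltW t0) eta4; lra.
  have eV0 : 0 <= e^-1 by rewrite invr_ge0 ltW.
  (* The origin of the 6 in K: 2(t + 1) <= 4 t because t >= 1, and 4 [trel C] k1 <= 2 t. *)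
  have h4 : 2 * (t + 1) + 2 * (2 * (trel C * k1)) <= 6 * t by lra.
  have := ler_wpM2r eV0 h4; lra.
pose b := 14 * (k1 * (K * ell)).
have b0 : 0 < b.
  have Kl : 0 < K * ell by apply: mulr_gt0; lra.
  by apply: mulr_gt0 => //; apply: mulr_gt0 => //; lra.
pose V := t * b ^+ 2.
have V0 : 0 < V by rewrite mulr_gt0 ?exprn_gt0.
set c := window_cst e.
pose s := trel C * (Num.sqrt (2 * V / e) + 2 * ln (2 / e)).
have hs : tmix C e <= t + s.
  have ln2e : 0 <= ln (2 / e) by apply: ln_ge0; rewrite ler_pdivlMr // mul1r; lra.
  apply: tmix_le; first exact: ltW.
  split; first by rewrite addr_ge0 ?(ltW t0) // mulr_ge0 ?addr_ge0 ?sqrtr_ge0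
    ?mulr_ge0 //; lra.
  move=> o; apply: tv_dist_after_window => //.
  exact: log_density_var_le.
apply: le_trans hs _; rewrite mulrDl mul1r lerD2l /s mulrDr.
have T0 : 0 <= trel C by lra.
have p0 : 0 <= trel C * k1 ^+ 2 * ell.
  by rewrite mulr_ge0 ?mulr_ge0 ?exprn_ge0 //; lra.
have sq_eta : Num.sqrt eta * t = Num.sqrt (eta * t ^+ 2).
  by rewrite sqrtrM ?(ltW eta0) // sqrtr_sqr ger0_norm // ltW.
have sqW : (trel C * k1 ^+ 2 * ell) <= Num.sqrt eta * t.
  rewrite -(ger0_norm p0) -sqrtr_sqr sqr_trel_back_window.
  rewrite sq_eta.
  rewrite ler_sqrt ?(mulr_ge0 (ltW eta0) (sqr_ge0 t)) //.
  apply: le_trans Ht _; rewrite ler_wpM2l ?(ltW eta0) //.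
  by rewrite -[leLHS]expr1 ler_weXn2l.
have hA : trel C * Num.sqrt (2 * V / e) <= 84 / e * Num.sqrt (2 / e) * (Num.sqrt
  eta * t).
  have -> : 2 * V / e = (2 / e) * t * b ^+ 2 by rewrite /V; ring.
  rewrite sqrtrM; last by rewrite mulr_ge0 ?divr_ge0 // ltW.
  rewrite sqrtr_sqr ger0_norm ?(ltW b0) //.
  rewrite sqrtrM; last by rewrite divr_ge0 // ltW.
  have -> : trel C * (Num.sqrt (2 / e) * Num.sqrt t * b) =
     84 / e * Num.sqrt (2 / e) * (trel C * k1 ^+ 2 * ell * Num.sqrt t).
    by rewrite /b /K; ring.
  rewrite ler_wpM2l ?mulr_ge0 ?sqrtr_ge0 ?invr_ge0 ?(ltW e0) //.
  rewrite -(ger0_norm p0) -sqrtr_sqr sqr_trel_back_window.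
  rewrite -[leLHS]sqrtrM; last by apply: le_trans W4; rewrite invr_ge0.
  rewrite sq_eta.
  rewrite ler_sqrt ?(mulr_ge0 (ltW eta0) (sqr_ge0 t)) //.
  by rewrite expr2 mulrA ler_wpM2r // ltW.
have hB : trel C <= Num.sqrt eta * t.
  apply: le_trans sqW; rewrite -mulrA ler_peMr // mulr_ege1 //.
  by rewrite exprn_ege1.
have ln2e : 0 <= 2 * ln (2 / e).
  by rewrite mulr_ge0 // ln_ge0 // ler_pdivlMr // mul1r; lra.
have := ler_wpM2l ln2e hB; rewrite /c /window_cst; lra.
Qed.

End LogGradient.

(** * Asymptotics *)

Lemma card_state_gt1 (R : realType) (C : markov_chain R) : 1 < (#|C|%:R : R).
Proof. by rewrite ltr1n state_gt1. Qed.

Section Asymptotics.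
Variables (R : realType) (C : nat -> markov_chain R).
Hypothesis hlim : trel (C n) *
     Num.sqrt ((1 + (back_dist (C n))%:R) ^+ 5 * (1 + ln (Delta (C n))) ^+ 3
               / ln (#|C n|%:R : R)) @[n --> \oo] --> (0 : R).

(** The squared hypothesis feeds [window_le_time]. The rank is uniform in t, so the bound passes to
    the infimum. *)
Lemma window_negligible (e eta : R) : 0 < e < 1 -> 0 < eta ->
  \forall n \near \oo, forall t, mixing_times (C n) (1 - e) t ->
    window (C n) <= eta * t.
Proof.
move=> /[dup] e01 /andP[e0 e1] eta0.
(* The first entry yields 4 delta / e <= eta, the second the condition 32 delta <= e. *)
pose delta := Num.min (eta * e / 4) (e / 32).
have d0 : 0 < delta by rewrite lt_min !divr_gt0 // mulr_gt0.
have d1 : 32 * delta <= e.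
  by rewrite mulrC -ler_pdivlMr // ge_min lexx orbT.
have d2 : 4 * delta / e <= eta.
  rewrite ler_pdivrMr // mulrC -ler_pdivlMr //.
  by rewrite ge_min lexx.
have sd0 : 0 < Num.sqrt delta by rewrite sqrtr_gt0.
have h := (cvgr0Pnorm_le _).1 hlim _ sd0.
near=> n => t [t0 Htv].
apply: (@le_trans _ _ (4 * delta / e * t)); last by rewrite ler_wpM2r.
apply: window_le_time => //; first exact: ltW.
have N0 : 0 < ln (#|C n|%:R : R) by rewrite ln_gt0 // card_state_gt1.
have l1 := ell_ge1 (C n); have k11 := k1_ge1 (C n).
have : `|trel (C n) * Num.sqrt ((1 + (back_dist (C n))%:R) ^+ 5 *
    (1 + ln (Delta (C n))) ^+ 3 / ln (#|C n|%:R : R))| <= Num.sqrt delta.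
  by near: n; exact: h.
have q0 : 0 <= (1 + (back_dist (C n))%:R) ^+ 5 *
    (1 + ln (Delta (C n))) ^+ 3 / ln (#|C n|%:R : R).
  by rewrite divr_ge0 ?(ltW N0) // mulr_ge0 ?exprn_ge0 //; lra.
rewrite -[X in X <= _]ger0_norm // -ler_sqr ?qualifE //= ?sqrtr_ge0 //.
rewrite !real_normK ?num_real // sqr_sqrtr ?(ltW d0) // exprMn sqr_sqrtr //.
by rewrite !mulrA ler_pdivrMr.
Unshelve. all: by end_near.
Qed.

Lemma tmix_large (e eta : R) : 0 < e < 1 -> 0 < eta ->
  \forall n \near \oo, 0 < tmix (C n) (1 - e) /\
    window (C n) <= eta * tmix (C n) (1 - e).
Proof.
move=> e01 eta0; have := window_negligible e01 eta0; apply: filterS => n h.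
have e0 : 0 < 1 - e by move: e01 => /andP[]; lra.
have hw : window (C n) <= eta * tmix (C n) (1 - e).
  rewrite mulrC -ler_pdivrMr //; apply: le_tmix => // t /h.
  by rewrite ler_pdivrMr // mulrC.
split => //; have := window_ge (C n); rewrite -(pmulr_rgt0 _ eta0); lra.
Qed.

Lemma trel_tmix_ratio_cvg (e : R) : 0 < e < 1 ->
  trel_tmix_ratio (C n) (1 - e) @[n --> \oo] --> 0%E.
Proof.
move=> e01.
(* Mixing times are eventually positive, so the extended quotient agrees with a real one. *)
pose r n := (back_dist (C n))%:R ^+ 2 * (1 + ln (Delta (C n))) * trel (C n) /
  Num.sqrt (tmix (C n) (1 - e)).
have rE : \forall n \near \oo, (r n)%:E = trel_tmix_ratio (C n) (1 - e).
  have := tmix_large e01 (@ltr01 R); apply: filterS => n [t0 _].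
  by rewrite /trel_tmix_ratio inver gt_eqF ?sqrtr_gt0 // -EFinM.
apply: (cvg_trans (near_eq_cvg rE)).
apply: cvg_EFin; first by near=> n.
apply/cvgr0Pnorm_le => d d0; have := tmix_large e01 (exprn_gt0 2 d0).
apply: filterS => n [t0 hw]; rewrite /= /r.
have l1 := ell_ge1 (C n); have k11 := k1_ge1 (C n); have T1 := trel_ge_half (C n).
have s0 : 0 < Num.sqrt (tmix (C n) (1 - e)) by rewrite sqrtr_gt0.
rewrite ger0_norm; last first.
  by rewrite divr_ge0 ?(ltW s0) // mulr_ge0 ?mulr_ge0 ?sqr_ge0 //; lra.
rewrite ler_pdivrMr // -[d]ger0_norm ?(ltW d0) // -sqrtr_sqr -sqrtrM ?sqr_ge0 //.
apply: le_trans (_ : Num.sqrt (window (C n)) <= _); last first.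
  by rewrite ler_sqrt // mulr_ge0 ?sqr_ge0 // ltW.
rewrite -sqr_trel_back_window sqrtr_sqr ger0_norm; last first.
  by rewrite mulr_ge0 ?mulr_ge0 ?sqr_ge0 //; lra.
rewrite mulrC mulrA ler_wpM2r //; first lra.
rewrite ler_wpM2l //; first lra.
by rewrite lerXn2r ?nnegrE ?ler0n //; lra.
Unshelve. all: by end_near.
Qed.

Hypothesis be : forall n, (1 <= n)%N -> (0 <= bakry_emery (C n))%E.

Lemma tmix_comparison (e rho : R) : 0 < e < 1 -> 0 < rho ->
  \forall n \near \oo, tmix (C n) e <= (1 + rho) * tmix (C n) (1 - e).
Proof.
move=> /[dup] e01 /andP[e0 e1] rho0.
pose c := window_cst e.
have c0 : 0 <= c.
  apply: addr_ge0; first by rewrite mulr_ge0 ?sqrtr_ge0 // divr_ge0 // ltW.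
  by apply: mulr_ge0 => //; apply: ln_ge0; rewrite ler_pdivlMr // mul1r; lra.
(* Two factors 1 + rho' arise, one from the window and one because the infimum need not be attained;
   (1 + rho')^2 <= 1 + 3 rho' as rho' <= 1. *)
pose rho' := Num.min 1 (rho / 3).
have r0 : 0 < rho' by rewrite lt_min ltr01 divr_gt0.
pose eta := Num.min 4^-1 ((rho' / (c + 1)) ^+ 2).
have eta0 : 0 < eta by rewrite lt_min invr_gt0 exprn_gt0 ?divr_gt0 ?ltr_wpDl.
have hc : c * Num.sqrt eta <= rho'.
  apply: (@le_trans _ _ (c * (rho' / (c + 1)))).
    have q0 : 0 <= rho' / (c + 1) by rewrite divr_ge0 ?(ltW r0) // addr_ge0.
    rewrite ler_wpM2l // -(ger0_norm q0).
    by rewrite -sqrtr_sqr ler_sqrt ?sqr_ge0 // ge_min lexx orbT.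
  rewrite mulrCA ler_piMr ?(ltW r0) // ler_pdivrMr ?ltr_wpDl //; lra.
near=> n.
have [t0 _] : 0 < tmix (C n) (1 - e) /\ window (C n) <= eta * tmix (C n) (1 - e).
  by near: n; exact: tmix_large.
have hW : forall t, mixing_times (C n) (1 - e) t -> window (C n) <= eta * t.
  by near: n; exact: window_negligible.
have n1 : (1 <= n)%N by near: n; exists 1%N.
have [t ht tlt] : exists2 t, mixing_times (C n) (1 - e) t &
    t < (1 + rho') * tmix (C n) (1 - e).
  by apply: tmix_lt; [lra|rewrite mulrDl mul1r ltrDl mulr_gt0].
have eta4 : eta <= 4^-1 by rewrite ge_min lexx.
apply: le_trans (tmix_window (be n1) e01 eta0 eta4 ht (hW t ht)) _.
apply: (@le_trans _ _ ((1 + rho') * ((1 + rho') * tmix (C n) (1 - e)))).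
  apply: ler_pM; [|by case: ht| |exact: ltW]; last by rewrite lerD2l.
  by rewrite addr_ge0 // mulr_ge0 ?sqrtr_ge0.
rewrite mulrA ler_wpM2r ?(ltW t0) //.
have : rho' <= 1 by rewrite ge_min lexx.
have : rho' <= rho / 3 by rewrite ge_min lexx orbT.
nra.
Unshelve. all: by end_near.
Qed.

(** The comparison at [e] bounds the ratio above by 1 + d; at [1 - e] it bounds it below by 1/(1 +
    d) >= 1 - d. *)
Lemma has_cutoff_of_negligible_window : has_cutoff C.
Proof.
move=> e /[dup] e01 /andP[e0 e1].
have f01 : 0 < 1 - e < 1 by lra.
pose r n := tmix (C n) e / tmix (C n) (1 - e).
have rE : \forall n \near \oo,
    (r n)%:E = ((tmix (C n) e)%:E / (tmix (C n) (1 - e))%:E)%E.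
  have := tmix_large e01 (@ltr01 R); apply: filterS => n [t0 _].
  by rewrite inver gt_eqF // -EFinM.
apply: (cvg_trans (near_eq_cvg rE)).
apply: cvg_EFin; first by near=> n.
apply/cvgrPdist_le => d d0; near=> n.
have [t0 _] : 0 < tmix (C n) (1 - e) /\ window (C n) <= 1 * tmix (C n) (1 - e).
  by near: n; exact: tmix_large.
have h1 : tmix (C n) e <= (1 + d) * tmix (C n) (1 - e).
  by near: n; exact: tmix_comparison.
have h2 : tmix (C n) (1 - e) <= (1 + d) * tmix (C n) (1 - (1 - e)).
  by near: n; exact: tmix_comparison.
rewrite subKr in h2; rewrite /= /r distrC ler_distl; apply/andP; split.
  rewrite ler_pdivlMr //; nra.
by rewrite ler_pdivrMr // addrC.
Unshelve. all: by end_near.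
Qed.

End Asymptotics.

Theorem proposition2p15 (R : realType) (C : nat -> markov_chain R)
  (hlim : trel (C n) *
     Num.sqrt ((1 + (back_dist (C n))%:R) ^+ 5 * (1 + ln (Delta (C n))) ^+ 3
               / ln (#|C n|%:R : R)) @[n --> \oo] --> (0 : R)) :
  (forall eps : R, 2^-1 <= eps < 1 ->
     trel_tmix_ratio (C n) eps @[n --> \oo] --> 0%E) /\
  (forall eps : R, 0 < eps < 2^-1 ->
     trel_tmix_ratio (C n) (1 - eps) @[n --> \oo] --> 0%E) /\
  ((forall n : nat, (1 <= n)%N -> (0 <= bakry_emery (C n))%E) -> has_cutoff C).
Proof.
split=> [eps eps1|]; last split=> [eps eps1|be].
- rewrite -[eps](subKr 1); apply: (trel_tmix_ratio_cvg hlim); lra.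
- by apply: (trel_tmix_ratio_cvg hlim); lra.
- exact: has_cutoff_of_negligible_window.
Qed.
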